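(* If Shortest Cycle in an $N$-node, $M$-edge directed weighted graph can be solved in $T(N,M)$ time, then Minimum Weight $k$-Cycle in an $n$-node, $m$-edge directed weighted graph can be solved in $\tilde{O}(T(n,m))$ time.
   Context: Graphs have integer edge weights. Shortest Cycle: find a directed cycle of minimum total edge weight. Minimum Weight $k$-Cycle ($k$ a constant): find a simple directed cycle on exactly $k$ vertices of minimum total edge weight. $\tilde{O}$ hides polylogarithmic factors. *)

(* Defs.v *)
From HB Require Import structures.
From mathcomp Require Import all_boot all_order all_algebra.

Set Implicit Arguments.
Unset Strict Implicit.
Unset Printing Implicit Defensive.

Import Order.TTheory GRing.Theory Num.Theory.
Local Open Scope ring_scope.

(* Simple directed graphs on the nodes 0, ..., n-1 with m arcs, given as a list
   of triples ((source, target), weight). There are neither loops nor parallel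
   arcs; antiparallel arcs are allowed. *)
Record wdigraph (n m : nat) := WDigraph {
  arcs : m.-tuple ('I_n * 'I_n * int);
  arcs_uniq : uniq [seq a.1 | a <- arcs];
  arcs_loopless : all (fun a => a.1.1 != a.1.2) arcs
}.

Section Cycles.
Variables (n m : nat) (G : wdigraph n m).

Definition arc : rel 'I_n := fun u v => (u, v) \in [seq a.1 | a <- arcs G].

(* By arcs_uniq the sum has exactly one term when arc u v holds. *)
Definition arc_weight (u v : 'I_n) : int :=
  \sum_(a <- arcs G | a.1 == (u, v)) a.2.

(* The cycle through x_0, ..., x_(l-1) is the sequence [:: x_0; ...; x_(l-1)],
   with a last arc from x_(l-1) to x_0; a node may be repeated. *)
Definition dicycle (c : seq 'I_n) : bool := (c != [::]) && cycle arc c.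

Definition simple_kcycle (k : nat) (c : seq 'I_n) : bool :=
  [&& dicycle c, uniq c & size c == k].

Definition cycle_weight (c : seq 'I_n) : int :=
  \sum_(e <- zip c (rot 1 c)) arc_weight e.1 e.2.

Definition no_negative_cycle : Prop :=
  forall c, dicycle c -> 0 <= cycle_weight c.

(* The answer [::] reports that no admissible cycle exists. *)
Definition min_weight_answer (admissible : pred (seq 'I_n)) (c : seq 'I_n) :
    Prop :=
  if c is [::] then forall c', ~~ admissible c'
  else admissible c /\
       forall c', admissible c' -> cycle_weight c <= cycle_weight c'.

End Cycles.

(* Random access machine with unit-cost instructions (Cook and Reckhow): the
   cells hold integers, and arithmetic is limited to addition and subtraction.
   Cells are indexed by int, so that indirect addressing is total. *)
Definition memory := int -> int.

Inductive instr :=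
| Const (a z : int)             (* M[a] := z *)
| Add (a b : int)               (* M[a] := M[a] + M[b] *)
| Sub (a b : int)               (* M[a] := M[a] - M[b] *)
| Fetch (a b : int)             (* M[a] := M[M[b]] *)
| Store (a b : int)             (* M[M[a]] := M[b] *)
| JumpPos (a : int) (l : nat)   (* if M[a] > 0 then goto l *)
| Halt.

Definition program := seq instr.

Definition update (M : memory) (a z : int) : memory :=
  fun b => if b == a then z else M b.

(* None means that the machine halts; running off the program halts too. *)
Definition step (p : program) (pc : nat) (M : memory) : option (nat * memory) :=
  match nth Halt p pc with
  | Const a z => Some (pc.+1, update M a z)
  | Add a b => Some (pc.+1, update M a (M a + M b))
  | Sub a b => Some (pc.+1, update M a (M a - M b))
  | Fetch a b => Some (pc.+1, update M a (M (M b)))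
  | Store a b => Some (pc.+1, update M (M a) (M b))
  | JumpPos a l => Some (if 0 < M a then l else pc.+1, M)
  | Halt => None
  end.

(* The final memory if p halts within t steps, the halting step included. *)
Fixpoint run (p : program) (t : nat) (pc : nat) (M : memory) : option memory :=
  if t is t'.+1 then
    if step p pc M is Some (pc', M') then run p t' pc' M' else Some M
  else None.

Definition encode (n m : nat) (G : wdigraph n m) : seq int :=
  n%:Z :: m%:Z ::
  flatten [seq [:: (nat_of_ord a.1.1)%:Z; (nat_of_ord a.1.2)%:Z; a.2] | a <- arcs G].

Definition input (n m : nat) (G : wdigraph n m) : memory :=
  fun a => if a is Posz i then nth 0 (encode G) i else 0.

(* Cell 0 holds the length of the sequence, the next cells its entries. *)
Definition holds_output (n : nat) (M : memory) (c : seq 'I_n) : Prop :=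
  M 0 = (size c)%:Z /\
  forall i : nat, (i < size c)%N ->
    M (i.+1)%:Z = (nth 0%N [seq nat_of_ord x | x <- c] i)%:Z.

Definition outputs (p : program) (t : nat) (n m : nat) (G : wdigraph n m)
    (c : seq 'I_n) : Prop :=
  exists2 M, run p t 0%N (input G) = Some M & holds_output M c.

(* With a negative cycle there is no cycle of minimum weight (it can be
   traversed repeatedly), so nothing is required on such graphs. *)
Definition shortest_cycle_solvable_in (T : nat -> nat -> nat) : Prop :=
  exists p : program, forall (n m : nat) (G : wdigraph n m),
    no_negative_cycle G ->
    exists2 c, outputs p (T n m) G c & min_weight_answer G (dicycle G) c.

Definition min_weight_kcycle_solvable_in (k : nat) (T : nat -> nat -> nat) :
    Prop :=
  exists p : program, forall (n m : nat) (G : wdigraph n m),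
    exists2 c, outputs p (T n m) G c &
      min_weight_answer G (simple_kcycle G k) c.

(* f = O~(T), where n is the number of nodes; the successor only avoids a
   vanishing logarithm for n <= 1. *)
Definition soft_O (T f : nat -> nat -> nat) : Prop :=
  exists C d : nat, forall n m : nat,
    (f n m <= C * T n m * (trunc_log 2 n).+1 ^ d)%N.

(* Main.v *)
Require Import Defs.
From mathcomp Require Import all_boot all_order all_algebra.
From mathcomp Require Import zify.

Set Implicit Arguments.
Unset Strict Implicit.
Unset Printing Implicit Defensive.

Import Order.TTheory GRing.Theory Num.Theory.

(** Colour the nodes with k colours, and raise the weight of an arc by B if it
    leads from a colour to the cyclically next one and by (k+1)B otherwise, where
    B is large compared with the sum of the absolute weights.  Every cycle is now
    positive, and the only cycles of weight about kB are closed walks through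
    k consecutive colours, which are simple k-cycles.  One call of the shortest
    cycle algorithm on this graph, which has the same n and m, therefore finds a
    minimum weight k-cycle among those that meet the colours 0, ..., k-1 in this
    order.  A family of polylogarithmically many colourings suffices: colour i is
    given to the nodes with prescribed values of k binary digits, chosen so as to
    separate the i-th node of the cycle from the others.

    Since T is arbitrary, the overhead must be paid for by T itself.  The O(m)
    work per colouring is covered because T(n,m) >= m/9: on a graph made of
    antiparallel pairs with unit weights, a weight that the algorithm does not
    read could be lowered without changing its output.  The calls share one
    memory, which cannot be cleared explicitly in time O(T); cells carry a time
    stamp instead. *)

(** * A structured language and its compilation to the machine *)

Section Language.
Local Open Scope ring_scope.

(** A layered graph with k copies of every node is ruled out: T is arbitrary, so its value at (kn,
    km) says nothing about T(n,m). Every instance passed on must keep n and m, and only the weights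
    are left to carry information. Moreover, the specification binds the assumed algorithm only on
    graphs without negative cycles, whereas the given weights may be negative; the penalty has to
    repair that as well. The colourings must come from one fixed program that can neither multiply
    nor divide. A seed consists of 2k^2 numbers between 1 and L, where L is about log n: for each of
    the k colours, k digit positions and k flags. All L^(2k^2) seeds are tried, and reading off a
    digit costs another factor L, whence the exponent 2k^2 + 1 of the logarithm. The assumed program
    is not called but interpreted, through a chain of tests whose length depends on that program
    only. *)

Inductive array := AIn | AVal | AStamp | AWt | ASeed | AOut.

(** [AIn] is the input and finally the output, [AVal] and [AStamp] form the simulated memory, [AWt]
    keeps the new weights, [ASeed] the current seed and [AOut] the best cycle so far. With six
    codes, 2 * code + 3 stays below the modulus 16 of the addresses. *)
Definition array_code (A : array) : nat :=
  match A with
  | AIn => 0 | AVal => 1 | AStamp => 2 | AWt => 3 | ASeed => 4 | AOut => 5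
  end.

Definition array_eqb (A B : array) : bool :=
  match A, B with
  | AIn, AIn | AVal, AVal | AStamp, AStamp
  | AWt, AWt | ASeed, ASeed | AOut, AOut => true
  | _, _ => false
  end.

Lemma array_eqP A B : reflect (A = B) (array_eqb A B).
Proof. by case: A; case: B; constructor. Qed.

Record store := MkStore { var : nat -> int; arr : array -> int -> int }.

Definition setv (s : store) (x : nat) (z : int) : store :=
  MkStore (fun y => if eqn y x then z else var s y) (arr s).

Definition seta (s : store) (A : array) (i z : int) : store :=
  MkStore (var s)
    (fun B j => if array_eqb B A && (j == i) then z else arr s B j).

(* [EIf c a b] is [a] when [c] is positive and [b] otherwise. *)
Inductive expr :=
| EConst (z : int)
| EVar (x : nat)
| EAdd (a b : expr)
| ESub (a b : expr)
| EArr (A : array) (e : expr)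
| EIf (c a b : expr).

Fixpoint eval (s : store) (e : expr) : int :=
  match e with
  | EConst z => z
  | EVar x => var s x
  | EAdd a b => eval s a + eval s b
  | ESub a b => eval s a - eval s b
  | EArr A e => arr s A (eval s e)
  | EIf c a b => if 0 < eval s c then eval s a else eval s b
  end.

Inductive cmd :=
| Skip
| Set_ (x : nat) (e : expr)
| SetA (A : array) (i e : expr)
| Cat (c d : cmd)
| If_ (e : expr) (c d : cmd)
| While (e : expr) (c : cmd).

(** Upper bounds on the steps of the compiled code, in general not exact: the 16 of an array access
    covers 12 steps for the address and 1 for the fetch. *)
Fixpoint ecost (e : expr) : nat :=
  match e with
  | EConst _ => 1
  | EVar _ => 2
  | EAdd a b | ESub a b => ecost a + ecost b + 1
  | EArr A e => ecost e + 16
  | EIf c a b => ecost c + ecost a + ecost b + 3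
  end%N.

Inductive exec : cmd -> nat -> store -> store -> Prop :=
| exec_skip s : exec Skip 0 s s
| exec_set x e s : exec (Set_ x e) (ecost e + 2) s (setv s x (eval s e))
| exec_seta A i e s :
    exec (SetA A i e) (ecost i + ecost e + 16) s
      (seta s A (eval s i) (eval s e))
| exec_cat c d t1 t2 s1 s2 s3 :
    exec c t1 s1 s2 -> exec d t2 s2 s3 -> exec (Cat c d) (t1 + t2) s1 s3
| exec_if_pos e c d t s s' :
    0 < eval s e -> exec c t s s' -> exec (If_ e c d) (ecost e + t + 3) s s'
| exec_if_neg e c d t s s' :
    ~~ (0 < eval s e) -> exec d t s s' ->
    exec (If_ e c d) (ecost e + t + 3) s s'
| exec_while_end e c s :
    ~~ (0 < eval s e) -> exec (While e c) (ecost e + 3) s s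
| exec_while e c t1 t2 s1 s2 s3 :
    0 < eval s1 e -> exec c t1 s1 s2 -> exec (While e c) t2 s2 s3 ->
    exec (While e c) (ecost e + t1 + t2 + 3) s1 s3.

(* Only input cells of nonnegative index keep their address; everything else
   is interleaved, modulo 16, in the negative half of the memory. *)
Definition temp (q : nat) : int := Negz (16 * q).
Definition vaddr (x : nat) : int := Negz (16 * x + 1).
Definition aaddr (A : array) (i : int) : int :=
  match i with
  | Posz j => if A is AIn then Posz j else Negz (16 * j + (2 * array_code A + 2))
  | Negz j => Negz (16 * j + (2 * array_code A + 3))
  end.

Lemma temp_inj : injective temp.
Proof. by move=> p q [] /=; lia. Qed.

Lemma vaddr_temp x q : vaddr x <> temp q.
Proof. by case; lia. Qed.

Lemma vaddr_inj : injective vaddr.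
Proof. by move=> x y []; lia. Qed.

Lemma aaddr_temp A i q : aaddr A i <> temp q.
Proof. by case: i => j; case: A => //=; case; lia. Qed.

Lemma aaddr_vaddr A i x : aaddr A i <> vaddr x.
Proof. by case: i => j; case: A => //=; case; lia. Qed.

Lemma aaddr_inj A B i j : aaddr A i = aaddr B j -> A = B /\ i = j.
Proof.
case: i => i; case: j => j; case: A; case: B => //=; case=> h;
  by [split=> //; congr Posz; lia | split=> //; congr Negz; lia | lia].
Qed.

Definition agrees (M : memory) (s : store) : Prop :=
  (forall x, M (vaddr x) = var s x) /\ (forall A i, M (aaddr A i) = arr s A i).

(** Code for an expression at depth [d] uses [temp d], [temp d.+1], ... as a stack above the values
    already computed; these are the only cells it may change, so a left operand survives the
    evaluation of the right one. *)
Definition same_below (d : nat) (M M' : memory) : Prop :=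
  forall a, (forall i, (d <= i)%N -> a <> temp i) -> M' a = M a.

Lemma same_below_refl d M : same_below d M M.
Proof. by []. Qed.

Lemma same_below_trans d M1 M2 M3 :
  same_below d M1 M2 -> same_below d M2 M3 -> same_below d M1 M3.
Proof. by move=> h1 h2 a ha; rewrite h2 // h1. Qed.

Lemma same_belowW d d' M M' :
  (d <= d')%N -> same_below d' M M' -> same_below d M M'.
Proof. by move=> le h a ha; apply: h => i hi; apply: ha; apply: leq_trans hi. Qed.

Lemma same_below_temp d i M z :
  (d <= i)%N -> same_below d M (update M (temp i) z).
Proof. by move=> le a ha; rewrite /update; case: eqP => // /ha; case. Qed.

Lemma same_below_lt d M M' i :
  same_below d M M' -> (i < d)%N -> M' (temp i) = M (temp i).
Proof. by move=> h lt; apply: h => j le /temp_inj; lia. Qed.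

Lemma same_below_agrees d M M' s : same_below d M M' -> agrees M s -> agrees M' s.
Proof.
move=> h [hv ha]; split=> [x|A i].
  by rewrite h // => j _; exact: vaddr_temp.
by rewrite h // => j _; exact: aaddr_temp.
Qed.

Lemma agrees_setv M s x z : agrees M s -> agrees (update M (vaddr x) z) (setv s x z).
Proof.
move=> [hv ha]; split=> [y|A i] /=; rewrite /update.
  case: eqP => [/vaddr_inj ->|ne]; first by rewrite eqnE eqxx.
  by rewrite eqnE; case: eqP => [e|]; [rewrite e in ne | rewrite hv].
by case: eqP => [/aaddr_vaddr|].
Qed.

Lemma agrees_seta M s A i z :
  agrees M s -> agrees (update M (aaddr A i) z) (seta s A i z).
Proof.
move=> [hv ha]; split=> [y|B j] /=; rewrite /update.
  by case: eqP => [/esym/aaddr_vaddr|].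
case: eqP => [/aaddr_inj [-> ->]|ne].
  by rewrite eqxx; case: array_eqP.
case: array_eqP => [e|] //=; case: eqP => [e'|] //=.
by case: ne; rewrite e e'.
Qed.

(** The number of steps is an upper bound, since [reach0] accepts any [t]; times can therefore be
    weakened freely. *)
Inductive reach (P : program) :
  nat -> nat -> memory -> nat -> memory -> Prop :=
| reach0 t pc M : reach P t pc M pc M
| reachS t pc M pc1 M1 pc2 M2 :
    step P pc M = Some (pc1, M1) -> reach P t pc1 M1 pc2 M2 ->
    reach P t.+1 pc M pc2 M2.

Lemma reach_trans P t1 t2 pc1 M1 pc2 M2 pc3 M3 :
  reach P t1 pc1 M1 pc2 M2 -> reach P t2 pc2 M2 pc3 M3 ->
  reach P (t1 + t2) pc1 M1 pc3 M3.
Proof.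
move=> h; elim: h => [t pc M|t pc M pc' M' pc'' M'' hs _ ih] h2.
  elim: h2 t => [t' pc' M'|t' pc' M' pc1' M1' pc2' M2' hs _ ih] t.
    exact: reach0.
  by rewrite addnS; apply: reachS hs _; exact: ih.
by rewrite addSn; apply: reachS hs _; exact: ih.
Qed.

Lemma reachW P t t' pc M pc' M' :
  (t <= t')%N -> reach P t pc M pc' M' -> reach P t' pc M pc' M'.
Proof.
move=> le h; rewrite -(subnK le) addnC; apply: reach_trans h _; exact: reach0.
Qed.

Lemma reach_run P t pc M pc' M' t' :
  reach P t pc M pc' M' -> (size P <= pc')%N -> (t < t')%N ->
  run P t' pc M = Some M'.
Proof.
move=> h; elim: h t' => [t0 pc0 M0|t0 pc0 M0 pc1 M1 pc2 M2 hs _ ih] [|t'] //.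
  by move=> hp _; rewrite /= /step nth_default.
by move=> hp lt; rewrite /= hs; apply: ih.
Qed.

(** Jump targets are absolute, so a fragment is compiled for the offset at which it is placed, and
    its correctness is stated inside an arbitrary surrounding program. *)
Definition code_at (P : program) (off : nat) (c : seq instr) : Prop :=
  forall i, (i < size c)%N -> nth Halt P (off + i) = nth Halt c i.

Lemma code_at_cat P off c1 c2 :
  code_at P off (c1 ++ c2) -> code_at P off c1 /\ code_at P (off + size c1) c2.
Proof.
move=> h; split=> i lt.
  by rewrite h ?nth_cat ?lt // size_cat ltn_addr.
by rewrite -addnA h ?nth_cat ?size_cat ?ltn_add2l // ltnNge leq_addr /= addKn.
Qed.

Definition straight (i : instr) : bool :=
  match i with JumpPos _ _ | Halt => false | _ => true end.

Definition exec_instr (M : memory) (i : instr) : memory :=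
  match i with
  | Const a z => update M a z
  | Add a b => update M a (M a + M b)
  | Defs.Sub a b => update M a (M a - M b)
  | Fetch a b => update M a (M (M b))
  | Store a b => update M (M a) (M b)
  | _ => M
  end.

Lemma reach_block P off c M :
  all straight c -> code_at P off c ->
  reach P (size c) off M (off + size c) (foldl exec_instr M c).
Proof.
elim: c off M => [|i c ih] off M /=; first by rewrite addn0 => _ _; exact: reach0.
case/andP=> hi hc hP.
have h0 := hP 0 isT; rewrite addn0 /= in h0.
have hs : step P off M = Some (off.+1, exec_instr M i).
  by rewrite /step h0; case: i hi {hP h0}.
apply: reachS hs _; rewrite addnS -addSn; apply: ih => // j lt.
by rewrite addSnnS hP.
Qed.

Lemma reach_const P off a z M :
  code_at P off [:: Const a z] -> reach P 1 off M (off + 1) (update M a z).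
Proof. by move=> h; apply: (reach_block M _ h). Qed.

Lemma reach_jump P off a l M :
  code_at P off [:: JumpPos a l] ->
  reach P 1 off M (if 0 < M a then l else (off + 1)%N) M.
Proof.
move=> h; have h0 := h 0 isT; rewrite addn0 /= in h0.
by apply: reachS (reach0 _ _ _ _); rewrite /step h0 addn1.
Qed.

Lemma updateE M a z b : update M a z b = if b == a then z else M b.
Proof. by []. Qed.

Lemma temp_eqE p q : (temp p == temp q) = (p == q).
Proof. exact: inj_eq temp_inj p q. Qed.

(** For the index [Negz j] the cell [temp d.+1] holds its successor -j on entry. Four doublings
    replace the missing multiplication by 16, and adding [Negz c] gives [Negz (16 * j + c)]. The
    final 1 makes the jump that follows unconditional. *)
Definition addr_neg (A : array) (d : nat) : seq instr :=
  [:: Add (temp d.+1) (temp d.+1); Add (temp d.+1) (temp d.+1);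
      Add (temp d.+1) (temp d.+1); Add (temp d.+1) (temp d.+1);
      Const (temp d) (Negz (2 * array_code A + 3));
      Add (temp d) (temp d.+1); Const (temp d.+1) 1].

Definition addr_pos (A : array) (d : nat) : seq instr :=
  if A is AIn then [::] else
  [:: Add (temp d) (temp d); Add (temp d) (temp d);
      Add (temp d) (temp d); Add (temp d) (temp d);
      Const (temp d.+1) (Negz (2 * array_code A + 2));
      Defs.Sub (temp d.+1) (temp d); Const (temp d) 0; Add (temp d) (temp d.+1)].

(** The machine only tests for > 0, so the sign of the index x is tested on x + 1. The nonnegative
    branch starts after 2 + 1 + 7 + 1 = 11 instructions. *)
Definition addr_code (off d : nat) (A : array) : seq instr :=
  [:: Const (temp d.+1) 1; Add (temp d.+1) (temp d)] ++
  [:: JumpPos (temp d.+1) (off + 11)] ++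
  addr_neg A d ++ [:: JumpPos (temp d.+1) (off + 11 + size (addr_pos A d))] ++
  addr_pos A d.

Arguments addr_code : simpl never.

Lemma addr_code_correct P off d A M :
  code_at P off (addr_code off d A) ->
  exists M', [/\ reach P 12 off M (off + size (addr_code off d A)) M',
    M' (temp d) = aaddr A (M (temp d)) & same_below d M M'].
Proof.
rewrite /addr_code => h.
have [h1 {}h] := code_at_cat h; have [h2 {}h] := code_at_cat h.
have [h3 {}h] := code_at_cat h; have [h4 h5] := code_at_cat h.
have e1 : d.+1 != d by lia.
have e2 : d != d.+1 by lia.
set M1 := foldl exec_instr M [:: Const (temp d.+1) 1; Add (temp d.+1) (temp d)].
have r1 : reach P 2 off M (off + 2) M1.
  by apply: (reach_block M _ h1).
have v1 : M1 (temp d.+1) = M (temp d) + 1.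
  by rewrite /M1 /= !(updateE, temp_eqE) !eqxx (negbTE e2) addrC.
have v2 : M1 (temp d) = M (temp d).
  by rewrite /M1 /= !(updateE, temp_eqE) (negbTE e2).
have s1 : same_below d M M1.
  by apply: same_below_trans; apply: same_below_temp.
clearbody M1; have := reach_jump M1 h2; rewrite /= v1; case: ifP => sg r2.
  exists (foldl exec_instr M1 (addr_pos A d)).
  have r3 := fun h => reach_block M1 h h5.
  have {}r3 : reach P 8 (off + 11) M1 (off + 11 + size (addr_pos A d))
      (foldl exec_instr M1 (addr_pos A d)).
    have -> : (off + 11 = off + 2 + 1 + 7 + 1)%N by lia.
    by apply: reachW (r3 _); case: (A).
  split.
  - rewrite -[X in (off + X)%N]/(11 + size (addr_pos A d))%N addnA.
    by apply: reachW (reach_trans (reach_trans r1 r2) r3).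
  - case: (M (temp d)) sg v2 {v1} => x sg v2; last by lia.
    by case: A {h h3 h4 h5 r2 r3} => //=;
      rewrite !(updateE, temp_eqE) !eqxx ?(negbTE e1) ?(negbTE e2) v2; lia.
  - apply: same_below_trans s1 _.
    by case: (A) => /=; first exact: same_below_refl;
      repeat (apply: same_below_trans; last by apply: same_below_temp; lia);
      exact: same_below_refl.
set M2 := foldl exec_instr M1 (addr_neg A d).
have r3 : reach P 7 (off + 2 + 1) M1 (off + 2 + 1 + 7) M2.
  by apply: (reach_block M1 _ h3).
exists M2.
have v3 : M2 (temp d.+1) = 1.
  by rewrite /M2 /= !(updateE, temp_eqE) !eqxx.
have r4 := reach_jump M2 h4; rewrite /= v3 /= in r4.
split.
- rewrite -[X in (off + X)%N]/(11 + size (addr_pos A d))%N addnA.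
  by apply: reachW (reach_trans (reach_trans (reach_trans r1 r2) r3) r4).
- case: (M (temp d)) sg v1 {v2} => x sg v1; first by lia.
  by case: A @M2 {h h3 h4 h5 r2 r3 r4 v3} => /=;
      rewrite !(updateE, temp_eqE) !eqxx ?(negbTE e1) ?(negbTE e2) v1; lia.
- apply: same_below_trans s1 _.
  by rewrite /M2 /=;
    repeat (apply: same_below_trans; last by apply: same_below_temp; lia);
    exact: same_below_refl.
Qed.

(** A failed test falls through, so the alternative branch of a conditional is laid out first; a
    jump on a cell just set to 1 then skips the other branch. *)
Fixpoint ecomp (off d : nat) (e : expr) : seq instr :=
  match e with
  | EConst z => [:: Const (temp d) z]
  | EVar x => [:: Const (temp d) 0; Add (temp d) (vaddr x)]
  | EAdd a b =>
      let c1 := ecomp off d a in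
      let c2 := ecomp (off + size c1) d.+1 b in
      c1 ++ c2 ++ [:: Add (temp d) (temp d.+1)]
  | ESub a b =>
      let c1 := ecomp off d a in
      let c2 := ecomp (off + size c1) d.+1 b in
      c1 ++ c2 ++ [:: Defs.Sub (temp d) (temp d.+1)]
  | EArr A e =>
      let c1 := ecomp off d e in
      c1 ++ addr_code (off + size c1) d A ++ [:: Fetch (temp d) (temp d)]
  | EIf c a b =>
      let c1 := ecomp off d c in
      let o2 := (off + size c1 + 1)%N in
      let c2 := ecomp o2 d b in
      let o3 := (o2 + size c2 + 1 + 1)%N in
      let c3 := ecomp o3 d a in
      c1 ++ [:: JumpPos (temp d) o3] ++ c2 ++
      [:: Const (temp d.+1) 1] ++ [:: JumpPos (temp d.+1) (o3 + size c3)] ++ c3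
  end.

Lemma ecomp_correct P s e off d M :
  code_at P off (ecomp off d e) -> agrees M s ->
  exists M', [/\ reach P (ecost e) off M (off + size (ecomp off d e)) M',
    M' (temp d) = eval s e & same_below d M M'].
Proof.
elim: e off d M => [z|x|a iha b ihb|a iha b ihb|A e ih|c ihc a iha b ihb] off d M.
- move=> h ag; exists (update M (temp d) z); split.
  + by apply: (reach_block M _ h).
  + by rewrite updateE eqxx.
  + exact: same_below_temp.
- move=> h ag; exists (foldl exec_instr M (ecomp off d (EVar x))); split.
  + by apply: (reach_block M _ h).
  + rewrite /= !updateE eqxx add0r; case: eqP => [/vaddr_temp //|_].
    by case: ag.
  + by apply: same_below_trans; apply: same_below_temp.
- rewrite /= => h ag.
  have [h1 {}h] := code_at_cat h; have [h2 h3] := code_at_cat h.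
  have [M1 [r1 v1 s1]] := iha _ _ _ h1 ag.
  have [M2 [r2 v2 s2]] := ihb _ _ _ h2 (same_below_agrees s1 ag).
  exists (update M2 (temp d) (M2 (temp d) + M2 (temp d.+1))); split.
  + rewrite !size_cat !addnA; apply: reach_trans (reach_trans r1 r2) _.
    by apply: (reach_block _ _ h3).
  + by rewrite updateE eqxx v2 (same_below_lt s2) ?v1.
  + apply: same_below_trans s1 _; apply: same_below_trans (same_belowW _ s2) _ => //.
    exact: same_below_temp.
- rewrite /= => h ag.
  have [h1 {}h] := code_at_cat h; have [h2 h3] := code_at_cat h.
  have [M1 [r1 v1 s1]] := iha _ _ _ h1 ag.
  have [M2 [r2 v2 s2]] := ihb _ _ _ h2 (same_below_agrees s1 ag).
  exists (update M2 (temp d) (M2 (temp d) - M2 (temp d.+1))); split.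
  + rewrite !size_cat !addnA; apply: reach_trans (reach_trans r1 r2) _.
    by apply: (reach_block _ _ h3).
  + by rewrite updateE eqxx v2 (same_below_lt s2) ?v1.
  + apply: same_below_trans s1 _; apply: same_below_trans (same_belowW _ s2) _ => //.
    exact: same_below_temp.
- cbn [ecomp] => h ag.
  have [h1 {}h] := code_at_cat h; have [h2 h3] := code_at_cat h.
  have [M1 [r1 v1 s1]] := ih _ _ _ h1 ag.
  have [M2 [r2 v2 s2]] := addr_code_correct M1 h2.
  have ag2 := same_below_agrees s2 (same_below_agrees s1 ag).
  exists (update M2 (temp d) (M2 (M2 (temp d)))); split.
  + rewrite !(size_cat (ecomp _ _ _), size_cat (addr_code _ _ _)) !addnA.
    apply: (@reachW _ (ecost e + 12 + 1)); first by rewrite /=; lia.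
    apply: reach_trans (reach_trans r1 r2) _.
    by apply: (reach_block _ _ h3).
  + by rewrite updateE eqxx v2 v1 /=; case: ag2.
  + apply: same_below_trans s1 _; apply: same_below_trans s2 _.
    exact: same_below_temp.
- cbn [ecomp eval] => h ag.
  have [h1 {}h] := code_at_cat h; have [h2 {}h] := code_at_cat h.
  have [h3 {}h] := code_at_cat h; have [h4 {}h] := code_at_cat h.
  have [h5 h6] := code_at_cat h.
  have [M1 [r1 v1 s1]] := ihc _ _ _ h1 ag.
  have ag1 := same_below_agrees s1 ag.
  set c1 := ecomp off d c in h1 h2 h3 h4 h5 h6 r1 *.
  set c2 := ecomp _ _ b in h2 h3 h4 h5 h6 *.
  set c3 := ecomp _ _ a in h2 h3 h4 h5 h6 *.
  rewrite !size_cat ![size [:: _]]/= !addnA.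
  have := reach_jump M1 h2; rewrite v1; case: ifP => sg r2.
    have [M2 [r3 v2 s2]] := iha _ _ _ h6 ag1.
    exists M2; split=> //; last exact: same_below_trans s1 s2.
    apply: reachW (reach_trans (reach_trans r1 r2) r3).
    by rewrite /=; lia.
  have [M2 [r3 v2 s2]] := ihb _ _ _ h3 ag1.
  pose M3 := update M2 (temp d.+1) 1.
  have r4 := reach_const M2 h4.
  have r5 := reach_jump M3 h5; rewrite /M3 updateE eqxx /= in r5.
  exists M3; split.
  + apply: reachW (reach_trans (reach_trans (reach_trans (reach_trans r1 r2) r3) r4) r5) => //.
    by rewrite /=; lia.
  + by rewrite /M3 updateE temp_eqE; case: eqP => [|_]; [lia|].
  + apply: same_below_trans s1 _; apply: same_below_trans s2 _.
    exact: same_below_temp.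
Qed.

Fixpoint comp (off : nat) (c : cmd) : seq instr :=
  match c with
  | Skip => [::]
  | Set_ x e =>
      ecomp off 0 e ++ [:: Const (vaddr x) 0; Add (vaddr x) (temp 0)]
  | SetA A i e =>
      let c1 := ecomp off 0 e in
      let c2 := ecomp (off + size c1) 1 i in
      c1 ++ c2 ++ addr_code (off + size c1 + size c2) 1 A ++
      [:: Store (temp 1) (temp 0)]
  | Cat c d => let c1 := comp off c in c1 ++ comp (off + size c1) d
  | If_ e c d =>
      let c1 := ecomp off 0 e in
      let o2 := (off + size c1 + 1)%N in
      let c2 := comp o2 d in
      let o3 := (o2 + size c2 + 1 + 1)%N in
      let c3 := comp o3 c in
      c1 ++ [:: JumpPos (temp 0) o3] ++ c2 ++
      [:: Const (temp 0) 1] ++ [:: JumpPos (temp 0) (o3 + size c3)] ++ c3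
  | While e c =>
      let c1 := ecomp off 0 e in
      let o2 := (off + size c1 + 1 + 1 + 1)%N in
      let c2 := comp o2 c in
      c1 ++ [:: JumpPos (temp 0) o2] ++
      [:: Const (temp 0) 1] ++ [:: JumpPos (temp 0) (o2 + size c2 + 1 + 1)] ++
      c2 ++ [:: Const (temp 0) 1] ++ [:: JumpPos (temp 0) off]
  end.

(** The induction is on the derivation of [exec] and not on the command, because one round of a loop
    leads back to the same loop at the same offset. *)
Lemma comp_correct P c t s s' off M :
  exec c t s s' -> code_at P off (comp off c) -> agrees M s ->
  exists2 M', reach P t off M (off + size (comp off c)) M' & agrees M' s'.
Proof.
move=> ex; elim: ex off M.
- by move=> {}s off M _ ag; exists M => //; rewrite addn0; exact: reach0.
- move=> x e {}s off M; cbn [comp] => h ag; have [h1 h2] := code_at_cat h.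
  have [M1 [r1 v1 s1]] := ecomp_correct h1 ag.
  have ag1 := same_below_agrees s1 ag.
  exists (foldl exec_instr M1 [:: Const (vaddr x) 0; Add (vaddr x) (temp 0)]).
    rewrite size_cat addnA; apply: reach_trans r1 _.
    by apply: (reach_block _ _ h2).
  rewrite /= -v1 updateE eqxx add0r updateE.
  case: eqP => [/esym/vaddr_temp //|_].
  have [hv ha] := agrees_setv x (M1 (temp 0)) ag1; split=> [y|A i].
    by rewrite -hv !updateE; case: eqP.
  by rewrite -ha !updateE; case: eqP.
- move=> A i e {}s off M; cbn [comp] => h ag.
  have [h1 {}h] := code_at_cat h; have [h2 {}h] := code_at_cat h.
  have [h3 h4] := code_at_cat h.
  have [M1 [r1 v1 s1]] := ecomp_correct h1 ag.
  have ag1 := same_below_agrees s1 ag.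
  have [M2 [r2 v2 s2]] := ecomp_correct h2 ag1.
  have ag2 := same_below_agrees s2 ag1.
  have [M3 [r3 v3 s3]] := addr_code_correct M2 h3.
  have ag3 := same_below_agrees s3 ag2.
  exists (update M3 (M3 (temp 1)) (M3 (temp 0))).
    rewrite !(size_cat (ecomp _ _ _), size_cat (addr_code _ _ _)) !addnA.
    apply: (@reachW _ (ecost e + ecost i + 12 + 1)); first by lia.
    apply: reach_trans (reach_trans (reach_trans r1 r2) r3) _.
    by apply: (reach_block _ _ h4).
  rewrite v3 v2 (same_below_lt s3) // (same_below_lt s2) // v1.
  exact: agrees_seta.
- move=> {}c d t1 t2 s1 s2 s3 _ ihc _ ihd off M; cbn [comp] => h ag.
  have [h1 h2] := code_at_cat h.
  have [M1 r1 ag1] := ihc _ _ h1 ag.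
  have [M2 r2 ag2] := ihd _ _ h2 ag1.
  by exists M2 => //; rewrite size_cat addnA; apply: reach_trans r1 r2.
- move=> e {}c d {}t {}s {}s' sg _ ih off M; cbn [comp] => h ag.
  have [h1 {}h] := code_at_cat h; have [h2 {}h] := code_at_cat h.
  have [h3 {}h] := code_at_cat h; have [h4 {}h] := code_at_cat h.
  have [h5 h6] := code_at_cat h.
  have [M1 [r1 v1 s1]] := ecomp_correct h1 ag.
  have ag1 := same_below_agrees s1 ag.
  have := reach_jump M1 h2; rewrite v1 sg => r2.
  have [M2 r3 ag2] := ih _ _ h6 ag1.
  exists M2 => //.
  rewrite !size_cat ![size [:: _]]/= !addnA.
  by apply: reachW (reach_trans (reach_trans r1 r2) r3); lia.
- move=> e {}c d {}t {}s {}s' /negbTE sg _ ih off M; cbn [comp] => h ag.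
  have [h1 {}h] := code_at_cat h; have [h2 {}h] := code_at_cat h.
  have [h3 {}h] := code_at_cat h; have [h4 {}h] := code_at_cat h.
  have [h5 h6] := code_at_cat h.
  have [M1 [r1 v1 s1]] := ecomp_correct h1 ag.
  have ag1 := same_below_agrees s1 ag.
  have := reach_jump M1 h2; rewrite v1 sg => r2.
  have [M2 r3 ag2] := ih _ _ h3 ag1.
  have r4 := reach_const M2 h4.
  have r5 := reach_jump (update M2 (temp 0) 1) h5.
  rewrite updateE eqxx /= in r5.
  exists (update M2 (temp 0) 1); last first.
    by apply: (@same_below_agrees 0) ag2; apply: same_below_temp.
  rewrite !size_cat ![size [:: _]]/= !addnA.
  apply: reachW (reach_trans (reach_trans (reach_trans (reach_trans r1 r2) r3) r4) r5).
  by rewrite /=; lia.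
- move=> e {}c {}s /negbTE sg off M; cbn [comp] => h ag.
  have [h1 {}h] := code_at_cat h; have [h2 {}h] := code_at_cat h.
  have [h3 {}h] := code_at_cat h; have [h4 _] := code_at_cat h.
  have [M1 [r1 v1 s1]] := ecomp_correct h1 ag.
  have ag1 := same_below_agrees s1 ag.
  have := reach_jump M1 h2; rewrite v1 sg => r2.
  have r3 := reach_const M1 h3.
  have r4 := reach_jump (update M1 (temp 0) 1) h4.
  rewrite updateE eqxx /= in r4.
  exists (update M1 (temp 0) 1); last first.
    by apply: (@same_below_agrees 0) ag1; apply: same_below_temp.
  rewrite !size_cat ![size [:: _]]/= !addnA.
  apply: reachW (reach_trans (reach_trans (reach_trans r1 r2) r3) r4).
  by rewrite /=; lia.
- move=> e {}c t1 t2 s1 s2 s3 sg _ ihc _ ihw off M; cbn [comp] => hh ag.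
  have h := hh.
  have [h1 {}h] := code_at_cat h; have [h2 {}h] := code_at_cat h.
  have [h3 {}h] := code_at_cat h; have [h4 {}h] := code_at_cat h.
  have [h5 {}h] := code_at_cat h; have [h6 h7] := code_at_cat h.
  have [M1 [r1 v1 ss1]] := ecomp_correct h1 ag.
  have ag1 := same_below_agrees ss1 ag.
  have := reach_jump M1 h2; rewrite v1 sg => r2.
  have [M2 r3 ag2] := ihc _ _ h5 ag1.
  have r4 := reach_const M2 h6.
  have r5 := reach_jump (update M2 (temp 0) 1) h7.
  rewrite updateE eqxx /= in r5.
  have ag3 : agrees (update M2 (temp 0) 1) s2.
    by apply: (@same_below_agrees 0) ag2; apply: same_below_temp.
  have [M3 r6 ag4] := ihw _ _ hh ag3.
  exists M3 => //.
  apply: reachW (reach_trans (reach_trans (reach_trans (reach_trans (reach_trans r1 r2) r3) r4) r5) r6).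
  by rewrite /=; lia.
Qed.

End Language.

(** * Total correctness with time bounds *)

Section Hoare.
Local Open Scope ring_scope.

Definition runs (c : cmd) (t : nat) (s : store) (Q : store -> Prop) : Prop :=
  exists t' s', [/\ (t' <= t)%N, exec c t' s s' & Q s'].

Lemma runs_conseq c t t' s (Q Q' : store -> Prop) :
  (t <= t')%N -> (forall s', Q s' -> Q' s') -> runs c t s Q -> runs c t' s Q'.
Proof.
move=> le h [t1 [s1 [le1 ex q]]]; exists t1, s1; split=> //; last exact: h.
exact: leq_trans le.
Qed.

Lemma runs_cat c d t1 t2 s (Q R : store -> Prop) :
  runs c t1 s Q -> (forall s', Q s' -> runs d t2 s' R) ->
  runs (Cat c d) (t1 + t2) s R.
Proof.
move=> [t1' [s1 [le1 ex1 q]]] h; have [t2' [s2 [le2 ex2 r]]] := h _ q.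
by exists (t1' + t2')%N, s2; split=> //; [apply: leq_add | apply: exec_cat ex2].
Qed.

Lemma runs_for e c t (I : nat -> store -> Prop) N s :
  I 0%N s ->
  (forall i s, (i < N)%N -> I i s -> 0 < eval s e /\ runs c t s (I i.+1)) ->
  (forall s, I N s -> ~~ (0 < eval s e)) ->
  runs (While e c) (N * (ecost e + t + 3) + (ecost e + 3)) s (I N).
Proof.
move=> h0 hs hN.
suff H : forall j i s, (i + j)%N = N -> I i s ->
    runs (While e c) (j * (ecost e + t + 3) + (ecost e + 3)) s (I N).
  exact: H h0.
elim=> [|j ih] i {h0}s hij hi.
  rewrite addn0 in hij; rewrite hij in hi.
  by exists (ecost e + 3)%N, s; split=> //; apply: exec_while_end; exact: hN.
have [|pos [t1 [s1 [le1 ex1 hi1]]]] := hs i s _ hi; first by lia.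
have [|t2 [s2 [le2 ex2 hi2]]] := ih i.+1 s1 _ hi1; first by lia.
exists (ecost e + t1 + t2 + 3)%N, s2; split=> //; last exact: exec_while ex2.
by rewrite mulSn; lia.
Qed.

Fixpoint loopfree (c : cmd) : bool :=
  match c with
  | Cat c d | If_ _ c d => loopfree c && loopfree d
  | While _ _ => false
  | _ => true
  end.

(** A command without loops has a computable final store, so its effect is obtained by
    simplification instead of through [exec]. The value on loops is a dummy. *)
Fixpoint lf (c : cmd) (s : store) : store :=
  match c with
  | Set_ x e => setv s x (eval s e)
  | SetA A i e => seta s A (eval s i) (eval s e)
  | Cat c d => lf d (lf c s)
  | If_ e c d => if 0 < eval s e then lf c s else lf d s
  | _ => s
  end.

Fixpoint cost (c : cmd) : nat :=
  match c with
  | Set_ x e => ecost e + 2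
  | SetA A i e => ecost i + ecost e + 16
  | Cat c d => cost c + cost d
  | If_ e c d => ecost e + cost c + cost d + 3
  | _ => 0
  end%N.

Lemma runs_lf c s (Q : store -> Prop) :
  loopfree c -> Q (lf c s) -> runs c (cost c) s Q.
Proof.
move=> hc q; suff [t [le ex]] : exists t, (t <= cost c)%N /\ exec c t s (lf c s).
  by exists t, (lf c s).
elim: c s hc {q} => //=.
- by move=> s _; exists 0%N; split=> //; constructor.
- by move=> x e s _; eexists; split; [|constructor].
- by move=> A i e s _; eexists; split; [|constructor].
- move=> c ihc d ihd s /andP[hc hd].
  have [t1 [le1 ex1]] := ihc s hc; have [t2 [le2 ex2]] := ihd (lf c s) hd.
  by exists (t1 + t2)%N; split; [apply: leq_add | apply: exec_cat ex2].
- move=> e c ihc d ihd s /andP[hc hd]; case: ifP => sg.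
    have [t [le ex]] := ihc s hc.
    by exists (ecost e + t + 3)%N; split; [lia | apply: exec_if_pos].
  have [t [le ex]] := ihd s hd.
  by exists (ecost e + t + 3)%N; split; [lia | apply: exec_if_neg => //; rewrite sg].
Qed.

Lemma runs_if e c d t s (Q : store -> Prop) :
  (0 < eval s e -> runs c t s Q) -> (~~ (0 < eval s e) -> runs d t s Q) ->
  runs (If_ e c d) (ecost e + t + 3) s Q.
Proof.
move=> hc hd; case: (boolP (0 < eval s e)) => sg.
  have [t1 [s1 [le ex q]]] := hc sg.
  by exists (ecost e + t1 + 3)%N, s1; split=> //; [lia | apply: exec_if_pos].
have [t1 [s1 [le ex q]]] := hd sg.
by exists (ecost e + t1 + 3)%N, s1; split=> //; [lia | apply: exec_if_neg].
Qed.

Fixpoint writes_var (c : cmd) (x : nat) : bool :=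
  match c with
  | Set_ y _ => eqn x y
  | Cat c d | If_ _ c d => writes_var c x || writes_var d x
  | While _ c => writes_var c x
  | _ => false
  end.

Fixpoint writes_arr (c : cmd) (A : array) : bool :=
  match c with
  | SetA B _ _ => array_eqb A B
  | Cat c d | If_ _ c d => writes_arr c A || writes_arr d A
  | While _ c => writes_arr c A
  | _ => false
  end.

(** What a command leaves alone is read off its syntax, so that postconditions need to mention only
    what it changes. *)
Definition frame (c : cmd) (s s' : store) : Prop :=
  (forall x, ~~ writes_var c x -> var s' x = var s x) /\
  (forall A, ~~ writes_arr c A -> arr s' A = arr s A).

Lemma exec_frame c t s s' : exec c t s s' -> frame c s s'.
Proof.
elim=> {c t s s'}; rewrite /frame /=.
- by [].
- by move=> x e s; split=> // y /negbTE /= ->.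
- by move=> A i e s; split=> // B /negbTE /= ->.
- move=> c d t1 t2 s1 s2 s3 _ [v1 a1] _ [v2 a2].
  by split=> [x|A]; rewrite negb_or => /andP[h1 h2]; rewrite ?v2 ?v1 ?a2 ?a1.
- move=> e c d t s s' _ _ [v1 a1].
  by split=> [x|A]; rewrite negb_or => /andP[h1 h2]; rewrite ?v1 ?a1.
- move=> e c d t s s' _ _ [v1 a1].
  by split=> [x|A]; rewrite negb_or => /andP[h1 h2]; rewrite ?v1 ?a1.
- by [].
- move=> e c t1 t2 s1 s2 s3 _ _ [v1 a1] _ [v2 a2].
  by split=> [x|A] h; rewrite ?v2 ?v1 ?a2 ?a1.
Qed.

Lemma runs_frame c t s (Q : store -> Prop) :
  runs c t s Q -> runs c t s (fun s' => Q s' /\ frame c s s').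
Proof.
by move=> [t1 [s1 [le ex q]]]; exists t1, s1; split=> //; split=> //;
  exact: exec_frame ex.
Qed.

End Hoare.

(** * Every algorithm for shortest cycles reads most of the weights *)

Section LowerBound.
Local Open Scope ring_scope.

Lemma nth_triples (U : Type) (f g h : U -> int) (s : seq U) q :
  let e := flatten [seq [:: f a; g a; h a] | a <- s] in
  [/\ nth 0 e (3 * q) = nth 0 (map f s) q,
      nth 0 e (3 * q + 1) = nth 0 (map g s) q &
      nth 0 e (3 * q + 2) = nth 0 (map h s) q].
Proof.
move=> e; rewrite {}/e; elim: s q => [|a s ih] q; first by rewrite !nth_nil.
case: q => [|q] //; have [e0 e1 e2] := ih q.
have -> : (3 * q.+1 = (3 * q).+3)%N by lia.
by rewrite !addSn /= e0 e1 e2.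
Qed.

(** Cells whose contents influence a value, an address or a jump. A cell that is merely overwritten
    does not count, and no instruction reads more than two. *)
Definition instr_reads (i : instr) (M : memory) : seq int :=
  match i with
  | Add a b | Defs.Sub a b | Store a b => [:: a; b]
  | Fetch a b => [:: b; M b]
  | JumpPos a _ => [:: a]
  | _ => [::]
  end.

Fixpoint reads (p : program) (t pc : nat) (M : memory) : seq int :=
  if t is t'.+1 then
    if step p pc M is Some (pc', M') then
      instr_reads (nth Halt p pc) M ++ reads p t' pc' M'
    else [::]
  else [::].

Lemma size_reads p t pc M : (size (reads p t pc M) <= 2 * t)%N.
Proof.
elim: t pc M => //= t ih pc M; case: (step p pc M) => [[pc' M']|] //.
rewrite size_cat mulnS leq_add //.
by case: (nth Halt p pc).
Qed.

(** Both runs proceed in lockstep: as [a] is never read, all addresses, written values and jumps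
    coincide, and the memories never differ outside [a]. *)
Lemma run_unread p t pc M M' a Mf :
  (forall b, b != a -> M' b = M b) -> a \notin reads p t pc M ->
  run p t pc M = Some Mf ->
  exists2 Mf', run p t pc M' = Some Mf' & forall b, b != a -> Mf' b = Mf b.
Proof.
elim: t pc M M' => //= t ih pc M M' agr.
have upd x z : forall b, b != a -> update M' x z b = update M x z b.
  by move=> b ne; rewrite /update; case: eqP => // _; exact: agr.
rewrite /step; case: (nth Halt p pc) => [x z|x y|x y|x y|x y|x l|] /=.
- by move=> nr; exact: ih (upd _ _) nr.
- rewrite !in_cons !negb_or => /and3P[nx ny nr].
  by rewrite (agr x) 1?eq_sym // (agr y) 1?eq_sym //; exact: ih (upd _ _) nr.
- rewrite !in_cons !negb_or => /and3P[nx ny nr].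
  by rewrite (agr x) 1?eq_sym // (agr y) 1?eq_sym //; exact: ih (upd _ _) nr.
- rewrite !in_cons !negb_or => /and3P[nx ny nr].
  by rewrite (agr y) 1?eq_sym // (agr (M y)) 1?eq_sym //; exact: ih (upd _ _) nr.
- rewrite !in_cons !negb_or => /and3P[nx ny nr].
  by rewrite (agr x) 1?eq_sym // (agr y) 1?eq_sym //; exact: ih (upd _ _) nr.
- rewrite !in_cons negb_or => /andP[nx nr].
  by rewrite (agr x) 1?eq_sym //; exact: ih agr nr.
- by move=> _ [<-]; exists M'.
Qed.

Lemma path_zip (U : Type) (e : rel U) x y p :
  path e x (rcons p y) = all (fun q => e q.1 q.2) (zip (x :: p) (rcons p y)).
Proof. by elim: p x => [|z p ih] x //=; rewrite ih. Qed.

Lemma cycle_zip (U : Type) (e : rel U) c :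
  cycle e c = all (fun q => e q.1 q.2) (zip c (rot 1 c)).
Proof. by case: c => [|x p] //; rewrite rot1_cons /= path_zip. Qed.

(** Arcs number 2q and 2q + 1 are antiparallel, so any prefix of length m contains half of m,
    rounded down, disjoint 2-cycles. *)
Fixpoint both_ways (U : Type) (s : seq (U * U)) : seq (U * U) :=
  if s is p :: s' then p :: (p.2, p.1) :: both_ways s' else [::].

Lemma mem_both_ways (U : eqType) (s : seq (U * U)) q :
  (q \in both_ways s) = (q \in s) || ((q.2, q.1) \in s).
Proof.
elim: s => //= p s ih; rewrite !in_cons ih; case: q p {ih} => [x y] [u v] /=.
have -> : ((x, y) == (v, u)) = ((y, x) == (u, v)).
  by rewrite !xpair_eqE andbC.
by case: (_ == _); case: (_ == _); case: (_ \in _).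
Qed.

Lemma uniq_both_ways n (s : seq ('I_n * 'I_n)) :
  all (fun p : 'I_n * 'I_n => (p.1 < p.2)%N) s -> uniq s -> uniq (both_ways s).
Proof.
elim: s => //= -[x y] s ih /= /andP[lt al] /andP[ns us].
have nsw : (y, x) \notin s.
  by apply: contraL al => h; apply/allPn; exists (y, x) => //=; lia.
rewrite !in_cons !mem_both_ways /= (negbTE ns) (negbTE nsw) ih // !orbF !andbT /=.
by rewrite xpair_eqE negb_and; apply/orP; left; apply: contraTneq lt => ->; rewrite ltnn.
Qed.

Lemma nth_both_ways (U : Type) (s : seq (U * U)) d q :
  (2 * q + 1 < size (both_ways s))%N ->
  nth d (both_ways s) (2 * q + 1) =
    ((nth d (both_ways s) (2 * q)).2, (nth d (both_ways s) (2 * q)).1).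
Proof.
elim: s q => // p s ih [|q] //.
have -> : (2 * q.+1 = (2 * q).+2)%N by lia.
by rewrite !addSn /= => lt; apply: ih; lia.
Qed.

Section Instance.
Variables (n m : nat) (d : 'I_n * 'I_n).

(** Contains every possible arc once, hence has length at least m as soon as some graph with n nodes
    and m arcs exists. The hard instances use its first m entries. *)
Definition all_pairs : seq ('I_n * 'I_n) :=
  both_ways [seq p : 'I_n * 'I_n <- enum {: 'I_n * 'I_n} | (p.1 < p.2)%N].

Lemma uniq_all_pairs : uniq all_pairs.
Proof.
apply: uniq_both_ways; first exact: filter_all.
by rewrite filter_uniq ?enum_uniq.
Qed.

Lemma mem_all_pairs p : (p \in all_pairs) = (p.1 != p.2).
Proof.
have up q : (q \in [seq p : 'I_n * 'I_n <- enum {: 'I_n * 'I_n} | (p.1 < p.2)%N])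
    = (q.1 < q.2)%N.
  by rewrite mem_filter mem_enum andbT.
rewrite mem_both_ways !up /=.
by rewrite -neq_ltn.
Qed.

Hypothesis hm : (m <= size all_pairs)%N.

Let pair (i : nat) : 'I_n * 'I_n := nth d all_pairs i.

Let pair_inj (i j : 'I_m) : pair i = pair j -> i = j.
Proof.
move/eqP; rewrite nth_uniq ?uniq_all_pairs ?(leq_trans (ltn_ord _) hm) //.
by move/eqP/val_inj.
Qed.

Variable w : 'I_m -> int.

Let the_arcs := [tuple (pair i, w i) | i < m].

Let the_uniq : uniq [seq a.1 | a <- the_arcs].
Proof.
rewrite /= -map_comp map_inj_uniq ?enum_uniq // => i j /=; exact: pair_inj.
Qed.

Let the_loopless : all (fun a => a.1.1 != a.1.2) the_arcs.
Proof.
apply/allP => a /mapP[i _ ->] /=; rewrite -mem_all_pairs.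
by rewrite mem_nth ?(leq_trans (ltn_ord _) hm).
Qed.

Definition hard_graph : wdigraph n m := WDigraph the_uniq the_loopless.

Lemma hard_arcP u v : reflect (exists i : 'I_m, (u, v) = pair i) (Defs.arc hard_graph u v).
Proof.
rewrite /Defs.arc /= -map_comp; apply: (iffP mapP) => [[i _ /= ->]|[i ->]].
  by exists i.
by exists i; rewrite ?mem_enum.
Qed.

Lemma hard_arc_weight u v (i : 'I_m) :
  (u, v) = pair i -> arc_weight hard_graph u v = w i.
Proof.
move=> e; rewrite /arc_weight e /= big_map big_enum_cond /=.
by rewrite (bigD1 i) //= big1 ?addr0 // => j /andP[/eqP /pair_inj -> /eqP].
Qed.

Lemma hard_arc_weight_ge0 u v :
  (forall i, 0 <= w i) -> 0 <= arc_weight hard_graph u v.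
Proof. by move=> h; rewrite /arc_weight /= big_map; apply: sumr_ge0 => i _ /=. Qed.

Lemma hard_no_negative : (forall i, 0 <= w i) -> no_negative_cycle hard_graph.
Proof. by move=> h c _; apply: sumr_ge0 => e _; exact: hard_arc_weight_ge0. Qed.

Lemma hard_input (j : nat) :
  [/\ input hard_graph 0 = n%:Z, input hard_graph 1 = m%:Z,
   input hard_graph (3 * j).+2%N = nth 0 [seq (nat_of_ord (pair i).1)%:Z | i : 'I_m <- enum 'I_m] j,
   input hard_graph (3 * j + 1).+2%N = nth 0 [seq (nat_of_ord (pair i).2)%:Z | i : 'I_m <- enum 'I_m] j &
   input hard_graph (3 * j + 2).+2%N = nth 0 [seq w i | i : 'I_m <- enum 'I_m] j].
Proof.
rewrite /input /encode /=.
have := @nth_triples _ (fun a : 'I_n * 'I_n * int => (nat_of_ord a.1.1)%:Z)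
  (fun a => (nat_of_ord a.1.2)%:Z) (fun a => a.2) the_arcs j.
by move=> /= [-> -> ->]; rewrite enumT -!map_comp.
Qed.

Lemma dicycle_hard2 q : (2 * q + 1 < m)%N ->
  dicycle hard_graph [:: (pair (2 * q)).1; (pair (2 * q)).2].
Proof.
move=> lt; have e := nth_both_ways d (leq_trans lt hm).
rewrite /dicycle /= andbT; apply/andP; split; apply/hard_arcP.
  have lt' : (2 * q < m)%N by lia.
  by exists (Ordinal lt') => /=; rewrite -surjective_pairing.
by exists (Ordinal lt) => /=; rewrite /pair e.
Qed.

End Instance.

Lemma hard_weight2 n m (d : 'I_n * 'I_n) (hm : (m <= size (all_pairs n))%N)
    (w : 'I_m -> int) x y :
  cycle_weight (hard_graph d hm w) [:: x; y] =
  arc_weight (hard_graph d hm w) x y + arc_weight (hard_graph d hm w) y x.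
Proof. by rewrite /cycle_weight /= !big_cons big_nil addr0. Qed.

Lemma hard_weight1 n m (d : 'I_n * 'I_n) (hm : (m <= size (all_pairs n))%N) c :
  let G := hard_graph d hm (fun=> 1) in
  dicycle G c -> cycle_weight G c = (size c)%:Z.
Proof.
move=> G /andP[_]; rewrite cycle_zip => /allP h.
have -> : cycle_weight G c = \sum_(e <- zip c (rot 1 c)) 1.
  rewrite /cycle_weight [LHS]big_seq [RHS]big_seq; apply: eq_bigr => e /h /hard_arcP[i ei].
  exact: hard_arc_weight ei.
by rewrite big_const_seq count_predT size1_zip ?size_rot //= -[RHS]natz iter_addr_0.
Qed.

(** All but at most two of the weights of the arcs number 2q must be read, and t steps read at most
    2t cells. Thus m/2, rounded down, is at most 2T + 2, and m <= 4T + 5 <= 9T because T > 0. The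
    given graph serves to show that hard instances of this size exist and that T is positive. *)
Lemma shortest_cycle_time_ge (T : nat -> nat -> nat) (p : program) :
  (forall n m (G : wdigraph n m), no_negative_cycle G ->
    exists2 c, outputs p (T n m) G c & min_weight_answer G (dicycle G) c) ->
  forall n m, wdigraph n m -> (0 < T n m)%N /\ (m <= 9 * T n m)%N.
Proof.
move=> hp n m G0.
have hm : (m <= size (all_pairs n))%N.
  rewrite -[X in (X <= _)%N](size_tuple (arcs G0)) -(size_map (fun a => a.1)).
  apply: uniq_leq_size; first exact: arcs_uniq.
  move=> q /mapP[a ha ->]; rewrite mem_all_pairs.
  exact: (allP (arcs_loopless G0) _ ha).
have T0 : (0 < T n m)%N.
  (* Zero weights make the instance admissible, so the program must halt on it, which no run of 0
     steps does. *)
  pose z : m.-tuple ('I_n * 'I_n * int) := [tuple of [seq (a.1, 0) | a <- arcs G0]].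
  have zu : uniq [seq a.1 | a <- z] by rewrite /= -map_comp; exact: arcs_uniq.
  have zl : all (fun a => a.1.1 != a.1.2) z.
    by rewrite all_map; exact: arcs_loopless.
  have [|c [M]] := hp n m (WDigraph zu zl).
    move=> c _; apply: sumr_ge0 => e _; rewrite /arc_weight /= big_map.
    exact: sumr_ge0.
  by case: (T n m).
split=> //; case: (leqP m 1) => [le1|gt1]; first by lia.
have d : 'I_n * 'I_n.
  by case: G0 hm => -[[|[a z] s] /= sz] _ _; [rewrite eq_sym in sz; lia | exact].
pose pair i := nth d (all_pairs n) i.
have lt_pairs i : (i < m)%N -> (i < size (all_pairs n))%N by move=> h; lia.
set G := hard_graph d hm (fun=> 1).
have [|c [M hrun [hM0 hMi]] hmin] := hp n m G; first exact: hard_no_negative.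
(* The first two arcs form a cycle of weight 2. Since there are no loops, the answer on unit weights
   is then itself a 2-cycle. *)
have dc0 := @dicycle_hard2 n m d hm (fun=> 1) 0 gt1.
have [dc hc] : dicycle G c /\ cycle_weight G c <= 2.
  case: c {hM0 hMi} hmin => [h|x c [hd hle]]; first by rewrite (negbTE (h _)) in dc0.
  split=> //; apply: le_trans (hle _ dc0) _; by rewrite hard_weight1.
rewrite hard_weight1 // in hc.
case: c dc hc hM0 hMi {hmin} => [|x [|y [|]]] //=.
  by rewrite /dicycle /= andbT => /hard_arcP [i /(f_equal (fun q => q \in all_pairs n))];
     rewrite mem_all_pairs /= eqxx mem_nth ?lt_pairs.
move=> _ _ hM0 hMi.
pose cell i : int := (3 * i + 2).+2%N.
have cell_inj : injective cell by move=> i j [] /=; lia.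
(* If this weight is not read, setting it to 0 leaves the answer x, y unchanged. But the 2-cycle
   number q now weighs 1, so the answer must contain an arc of weight 0, and the only such arc is
   number 2q: it is (x, y) or (y, x). *)
have key q : (2 * q + 1 < m)%N ->
    cell (2 * q)%N \in reads p (T n m) 0 (input G) ++
      [:: cell (index (x, y) (all_pairs n)); cell (index (y, x) (all_pairs n))].
  move=> lt; rewrite mem_cat; case: (boolP (_ \in reads _ _ _ _)) => //= nr.
  have lt' : (2 * q < m)%N by lia.
  pose j := Ordinal lt'.
  pose w i : int := if i == j then 0 else 1.
  set G' := hard_graph d hm w.
  have agr b : b != cell (2 * q)%N -> input G' b = input G b.
    case: b => // b; case: b => [|[|b]] //.
    rewrite (divn_eq b 3) mulnC; have := @ltn_pmod b 3 isT.
    have [_ _ e0 e1 e2] := @hard_input n m d hm (fun=> 1) (b %/ 3).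
    have [_ _ e0' e1' e2'] := @hard_input n m d hm w (b %/ 3).
    case: (b %% 3)%N => [|[|[|]]] // _ ne.
    - by rewrite addn0 e0 e0'.
    - by rewrite e1 e1'.
    - rewrite e2 e2'; set r := (b %/ 3)%N in ne *.
      case: (ltnP r m) => hr; last first.
        by do 2!(rewrite nth_default; last by rewrite size_map size_enum_ord).
      have nm (f : 'I_m -> int) : nth 0 [seq f i | i <- enum 'I_m] r = f (nth j (enum 'I_m) r).
        by rewrite (nth_map j) ?size_enum_ord.
      rewrite !nm /w.
      case: eqP => // /(f_equal (@nat_of_ord m)); rewrite nth_enum_ord // => er.
      by rewrite er in ne; rewrite /cell eqxx in ne.
  have [M' hrun' agr'] := run_unread agr nr hrun.
  have [|c' [M'' hrun'' [h0 hi]] hmin] := hp n m G'.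
    by apply: hard_no_negative => i; rewrite /w; case: ifP.
  move: hrun''; rewrite hrun' => -[eM]; rewrite -{}eM {M''} in h0 hi.
  (* The output of length 2 occupies the cells 0, 1 and 2, while weight cells start at 4; the
     modified cell is not among them. *)
  rewrite agr' // hM0 in h0.
  have dcq := @dicycle_hard2 n m d hm w q lt.
  case: c' h0 hi hmin => [|x' [|y' [|]]] //= _ hi [hd hle].
  have ex : x' = x.
    apply: val_inj; have := hi 0%N isT; rewrite agr' // (hMi 0%N isT) /=; by case.
  have ey : y' = y.
    apply: val_inj; have := hi 1%N isT; rewrite agr'; last by apply/eqP; case; lia.
    by rewrite (hMi 1%N isT) /=; case.
  have {hle} := hle _ dcq; rewrite !hard_weight2 ex ey in hd *.
  have e := nth_both_ways d (leq_trans lt hm).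
  have -> : arc_weight G' (pair (2 * q)%N).1 (pair (2 * q)%N).2 = 0.
    rewrite (@hard_arc_weight _ _ _ _ _ _ _ j) -?surjective_pairing //.
    by rewrite /w eqxx.
  have -> : arc_weight G' (pair (2 * q)%N).2 (pair (2 * q)%N).1 = 1.
    rewrite (@hard_arc_weight _ _ _ _ _ _ _ (Ordinal lt)) //.
    by rewrite /w -val_eqE /=; case: eqP => //; lia.
  move: hd; rewrite /dicycle /= andbT => /andP[/hard_arcP[i1 h1] /hard_arcP[i2 h2]].
  rewrite (@hard_arc_weight _ _ _ _ _ _ _ _ h1) (@hard_arc_weight _ _ _ _ _ _ _ _ h2).
  rewrite !inE h1 h2 !index_uniq ?uniq_all_pairs ?lt_pairs //.
  rewrite /w; case: eqP => [->|_]; first by rewrite eqxx.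
  by case: eqP => [->|_]; first by rewrite eqxx orbT.
have : (m./2 <= 2 * T n m + 2)%N.
  apply: (@leq_trans (size (reads p (T n m) 0 (input G) ++
      [:: cell (index (x, y) (all_pairs n)); cell (index (y, x) (all_pairs n))]))).
    rewrite -[X in (X <= _)%N](size_iota 0) -(size_map (fun q => cell (2 * q)%N)).
    apply: uniq_leq_size.
      by rewrite map_inj_uniq ?iota_uniq // => i j /cell_inj; lia.
    by move=> a /mapP[q]; rewrite mem_iota => hq ->; apply: key; lia.
  by rewrite size_cat leq_add // size_reads.
by lia.
Qed.

End LowerBound.

(** * Colour coding *)

Section Colour.
Variables (k n : nat).

(** Doubling modulo n, for x < n. Expanding the fraction v / n instead of v yields digits from the
    leading one by additions and subtractions alone. *)
Definition double_mod (x : nat) : nat := if n <= 2 * x then 2 * x - n else 2 * x.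

(* Equals the [b]-th binary digit of [v / n], for [b >= 1]. *)
Definition digit (b v : nat) : bool := n <= 2 * iter b.-1 double_mod v.

Lemma iter_double_mod_lt b v : v < n -> iter b double_mod v < n.
Proof.
by move=> hv; elim: b => //= b; move: (iter b _ v) => x hx;
  rewrite /double_mod; case: ifP; lia.
Qed.

(** As long as the digits agree, doubling modulo n subtracts the same amount on both sides, so the
    difference doubles. After L rounds it is 2^L (v - u), yet both remainders are below n <= 2^L. *)
Lemma digit_separates L u v :
  u < n -> v < n -> n <= 2 ^ L ->
  (forall b, 0 < b <= L -> digit b u = digit b v) -> u = v.
Proof.
wlog le : u v / u <= v.
  move=> H hu hv hL hb; case: (leqP u v) => [|/ltnW] le; first exact: H.
  by apply/esym/H => // b hb'; rewrite hb.
move=> hu hv hL hb.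
have key b : b <= L ->
    iter b double_mod v = iter b double_mod u + 2 ^ b * (v - u).
  elim: b => [|b ih] hbL /=; first by rewrite expn0 mul1n; lia.
  have := hb b.+1 hbL; rewrite /digit /=.
  have {}ih := ih (ltnW hbL).
  rewrite expnS -mulnA; move: ih.
  move: (2 ^ b * _) (iter b _ v) (iter b _ u) => p y x.
  by rewrite /double_mod => h1 h2; move: h2; case: ifP; case: ifP => // *; lia.
have := iter_double_mod_lt L hv; rewrite key //.
case: (posnP (v - u)) => [|pos]; first by lia.
have : 2 ^ L <= 2 ^ L * (v - u) by rewrite leq_pmulr.
by lia.
Qed.

Variable s : nat -> nat.

(* Entries 2q and 2q+1 of the seed, with q = i k + j, are a digit position and a
   flag (1 or more) telling which value of that digit colour i requires. *)
Definition pass (v i j : nat) : bool :=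
  digit (s (2 * (i * k + j))) v (+) (1 < s (2 * (i * k + j) + 1)).

(** A node that passes for several colours gets the last one, a node that passes for none gets 0.
    Neither convention matters on the cycle a seed is chosen for. *)
Definition colour (v : nat) : nat :=
  foldl (fun acc i => if all (pass v i) (iota 0 k) then i else acc) 0 (iota 0 k).

Lemma colour_lt v : 0 < k -> colour v < k.
Proof.
move=> k0; rewrite /colour.
suff gen l acc : all (fun i => i < k) l -> acc < k ->
    foldl (fun acc i => if all (pass v i) (iota 0 k) then i else acc) acc l < k.
  by apply: gen => //; apply/allP => i; rewrite mem_iota.
elim: l acc => //= i l ih acc /andP[hi hl] ha.
by apply: ih => //; case: ifP.
Qed.

Lemma colour_unique v i :
  i < k -> (forall j, j < k -> all (pass v j) (iota 0 k) = (j == i)) ->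
  colour v = i.
Proof.
move=> hi h; rewrite /colour.
have fix_i l : all (fun j => j < k) l ->
    foldl (fun acc j => if all (pass v j) (iota 0 k) then j else acc) i l = i.
  elim: l => //= j l ih /andP[hj hl]; rewrite h //.
  by case: eqP => [->|_]; exact: ih.
suff gen l acc : all (fun j => j < k) l -> i \in l ->
    foldl (fun acc j => if all (pass v j) (iota 0 k) then j else acc) acc l = i.
  by apply: gen; [apply/allP => j |]; rewrite mem_iota.
elim: l acc => //= j l ih acc /andP[hj hl]; rewrite in_cons h // [j == i]eq_sym.
by case: eqP => [<- _|_ /=]; [exact: fix_i | exact: ih].
Qed.

End Colour.

(** For equal nodes there is nothing to separate, and 1 is just a legal digit position. *)
Definition separator (n L u v : nat) : nat :=
  if u == v then 1
  else (find (fun b => digit n b.+1 u != digit n b.+1 v) (iota 0 L)).+1.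

Lemma separatorP n L u v :
  u < n -> v < n -> n <= 2 ^ L -> 0 < L ->
  0 < separator n L u v <= L /\
  (u != v -> digit n (separator n L u v) u != digit n (separator n L u v) v).
Proof.
move=> hu hv hL L0; rewrite /separator; case: eqP => // ne.
have hh : has (fun b => digit n b.+1 u != digit n b.+1 v) (iota 0 L).
  apply/negPn/negP => /hasPn h; apply: ne; apply: digit_separates hL _ => //.
  move=> [|b] //= hb; have := h b; rewrite mem_iota => /(_ hb).
  by rewrite negbK => /eqP.
have lt := hh; rewrite has_find size_iota in lt.
split=> // _; have := nth_find 0 hh; by rewrite nth_iota.
Qed.

(** Test j of colour i looks at a digit in which c_i and c_j differ and demands the value it has at
    c_i. So c_i passes all tests of colour i, and c_j fails test j of that colour. Flags take the
    values 1 and 2 but share the range 1..L of the positions, which is why L > 1 is assumed. *)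
Lemma colour_realizes k n L (c : seq nat) :
  uniq c -> size c = k -> 0 < n -> all (fun v => v < n) c ->
  n <= 2 ^ L -> 1 < L ->
  exists2 s : nat -> nat, (forall t, 0 < s t <= L) &
    forall i, i < k -> colour k n s (nth 0 c i) = i.
Proof.
move=> uc sc n0 cn hL L1.
have ltn_c i : nth 0 c i < n.
  by case: (ltnP i (size c)) => h; [exact: (allP cn) _ (mem_nth _ h) | rewrite nth_default].
pose b i j := separator n L (nth 0 c i) (nth 0 c j).
pose s t := if odd t then
    if digit n (b (t./2 %/ k) (t./2 %% k)) (nth 0 c (t./2 %/ k)) then 1 else 2
  else b (t./2 %/ k) (t./2 %% k).
have hb i j : 0 < b i j <= L.
  by case: (@separatorP n L (nth 0 c i) (nth 0 c j)) => //; lia.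
exists s => [t|i hi].
  by rewrite /s; case: ifP => // _; case: ifP => _; lia.
have sE j l : l < k -> s (2 * (j * k + l)) = b j l /\
    (1 < s (2 * (j * k + l) + 1)) = ~~ digit n (b j l) (nth 0 c j).
  move=> hl; have k0 : 0 < k by lia.
  have e1 : (j * k + l) %/ k = j by rewrite divnMDl // divn_small ?addn0.
  have e2 : (j * k + l) %% k = l by rewrite modnMDl modn_small.
  rewrite /s addn1 /= mul2n odd_double /= uphalf_double doubleK e1 e2.
  by case: (digit _ _ _).
apply: colour_unique => // j hj; apply/allP/eqP => [h|-> l].
  apply/eqP/negPn/negP => ne.
  have := h i; rewrite mem_iota /pass => /(_ hi).
  have [-> ->] := sE j i hi.
  have [_] := @separatorP n L (nth 0 c j) (nth 0 c i) (ltn_c j) (ltn_c i) hL (ltnW L1).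
  rewrite nth_uniq ?sc // => /(_ ne); rewrite -/(b j i).
  by case: (digit _ _ _); case: (digit _ _ _).
rewrite mem_iota /pass => hl; have [-> ->] := sE i l hl.
by case: (digit _ _ _).
Qed.

(** * Penalties that turn properly coloured k-cycles into shortest cycles *)

Section Reweight.
Local Open Scope ring_scope.
Variables (n m : nat) (G : wdigraph n m).

Lemma filter_arc a : a \in tval (arcs G) ->
  [seq b <- arcs G | b.1 == a.1] = [:: a].
Proof.
move=> ha; have : size [seq b <- arcs G | b.1 == a.1] = 1%N.
  rewrite size_filter -(count_map (fun b => b.1) (pred1 a.1)).
  by rewrite count_uniq_mem ?arcs_uniq // map_f.
have : a \in [seq b <- arcs G | b.1 == a.1] by rewrite mem_filter eqxx ha.
by case: [seq _ <- _ | _] => [|b [|]] //; rewrite inE => /eqP ->.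
Qed.

Lemma arc_weightE a : a \in tval (arcs G) -> arc_weight G a.1.1 a.1.2 = a.2.
Proof.
move=> ha; rewrite /arc_weight -big_filter -surjective_pairing filter_arc //.
by rewrite big_seq1.
Qed.

Lemma arcP u v :
  reflect (exists2 a, a \in tval (arcs G) & a.1 = (u, v)) (Defs.arc G u v).
Proof. by apply: (iffP mapP) => -[a ha e]; exists a. Qed.

Variables (S : int).
Hypothesis hS : forall a, a \in tval (arcs G) -> `|a.2| <= S.

Lemma arc_weight_le u v : Defs.arc G u v -> `|arc_weight G u v| <= S.
Proof.
by case/arcP => a ha e; have := arc_weightE ha; rewrite e /= => ->; exact: hS.
Qed.

Lemma cycle_weight_le c : dicycle G c -> `|cycle_weight G c| <= S *+ size c.
Proof.
case/andP=> _; rewrite cycle_zip => /allP h.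
apply: le_trans (ler_norm_sum _ _ _) _.
rewrite [X in X <= _]big_seq; apply: le_trans (_ : \sum_(e <- zip c (rot 1 c) | e \in zip c (rot 1 c)) S <= _).
  by apply: ler_sum => e /h; exact: arc_weight_le.
by rewrite -big_seq big_const_seq count_predT size1_zip ?size_rot //= iter_addr_0.
Qed.

Variables (k : nat) (col : 'I_n -> nat) (B : int).
Hypothesis k0 : (0 < k)%N.
Hypothesis col_lt : forall u, (col u < k)%N.
Hypothesis hB : S *+ (2 * k + 2) + 1 = B.

Definition good (u v : 'I_n) : bool := (col v == (col u).+1 %% k)%N.

(** A cycle of length l with b bad arcs gains B(l + kb). A single bad arc thus brings this to at
    least (k + 1)B, more than k good arcs cost. *)
Definition penalty (u v : 'I_n) : int := if good u v then B else B *+ k.+1.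

Definition new_arcs : m.-tuple ('I_n * 'I_n * int) :=
  [tuple of [seq (a.1, a.2 + penalty a.1.1 a.1.2) | a <- arcs G]].

Lemma new_arcs_uniq : uniq [seq a.1 | a <- new_arcs].
Proof. by rewrite /= -map_comp; exact: arcs_uniq. Qed.

Lemma new_arcs_loopless : all (fun a => a.1.1 != a.1.2) new_arcs.
Proof. by rewrite all_map; exact: arcs_loopless. Qed.

Definition reweighted : wdigraph n m :=
  WDigraph new_arcs_uniq new_arcs_loopless.

Lemma arc_reweighted u v : Defs.arc reweighted u v = Defs.arc G u v.
Proof. by rewrite /Defs.arc /= -map_comp. Qed.

Lemma dicycle_reweighted c : dicycle reweighted c = dicycle G c.
Proof.
by rewrite /dicycle; congr (_ && _); apply: eq_cycle => u v; exact: arc_reweighted.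
Qed.

Lemma arc_weight_reweighted u v : Defs.arc G u v ->
  arc_weight reweighted u v = arc_weight G u v + penalty u v.
Proof.
case/arcP=> -[[u' v'] x] ha [eu ev]; rewrite eu ev in ha.
rewrite /arc_weight /= big_map /= -big_filter -[in RHS]big_filter.
by have /= -> := filter_arc ha; rewrite !big_seq1.
Qed.

Definition bad_count (c : seq 'I_n) : nat :=
  count (fun e => ~~ good e.1 e.2) (zip c (rot 1 c)).

Lemma cycle_weight_reweighted c : dicycle G c ->
  cycle_weight reweighted c =
  cycle_weight G c + (B *+ size c + B *+ (k * bad_count c)).
Proof.
case/andP=> _; rewrite cycle_zip /cycle_weight /bad_count.
have -> : B *+ size c = B *+ size (zip c (rot 1 c)) by rewrite size1_zip ?size_rot.
elim: (zip c _) => [|e s ih] /=; first by rewrite !big_nil muln0 !mulr0n !addr0.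
case/andP=> he hs; rewrite !big_cons ih // arc_weight_reweighted // /penalty.
by case: (good _ _) => /=; rewrite ?add0n ?mulnDr ?muln1 ?mulrSr ?mulrnDr; lia.
Qed.

Lemma path_colour x p i : path good x p -> (i <= size p)%N ->
  col (nth x (x :: p) i) = ((col x + i) %% k)%N.
Proof.
elim: p x i => [|y p ih] x [|i] //=.
- by rewrite addn0 modn_small.
- by rewrite addn0 modn_small.
case/andP=> /eqP e hp hi; rewrite (set_nth_default y) //.
by rewrite ih // e modnDml addSnnS.
Qed.

(** The colour advances by 1 modulo k at every arc. Returning to the first colour forces k to divide
    the length, and k consecutive nodes have k distinct colours. *)
Lemma good_cycle c : c != [::] -> cycle good c ->
  (k %| size c)%N /\ (size c = k -> uniq c).
Proof.
case: c => // x p _ /= hp.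
have h i : (i <= (size p).+1)%N ->
    col (nth x (x :: rcons p x) i) = ((col x + i) %% k)%N.
  by move=> hi; apply: path_colour; rewrite ?size_rcons.
split.
  have := h (size p).+1 (leqnn _); rewrite /= nth_rcons ltnn eqxx => /esym e.
  have : (col x + (size p).+1 == col x + 0 %[mod k])%N by rewrite e addn0 modn_small.
  by rewrite eqn_modDl mod0n.
move=> sz; suff : uniq [seq col i | i <- x :: p] by exact: map_uniq.
have -> : [seq col i | i <- x :: p] = [seq ((col x + i) %% k)%N | i <- iota 0 k].
  apply: (@eq_from_nth _ 0%N); first rewrite !size_map size_iota.
    by rewrite -sz.
  move=> i; rewrite size_map => hi; have hik : (i < k)%N by rewrite -sz.
  rewrite (nth_map x) // (nth_map 0%N) ?size_iota // nth_iota // add0n.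
  rewrite -h; last exact: ltnW.
  by rewrite -[x :: rcons p x]/(rcons (x :: p) x) nth_rcons hi.
rewrite map_inj_in_uniq ?iota_uniq // => i j; rewrite !mem_iota /= => hi hj.
by move/eqP; rewrite eqn_modDl !modn_small // => /eqP.
Qed.

Lemma S_ge0 c : dicycle G c -> 0 <= S.
Proof.
case: c => // x c /andP[_]; rewrite cycle_zip rot1_cons => /allP h.
case: c h => [|y c] /= h.
  by apply: le_trans (normr_ge0 _) (arc_weight_le (h (x, x) _)); rewrite inE.
by apply: le_trans (normr_ge0 _) (arc_weight_le (h (x, y) _)); rewrite inE eqxx.
Qed.

Lemma good_cycleE c : bad_count c = 0%N -> cycle good c.
Proof.
by move=> h; rewrite cycle_zip all_count -(count_predC (fun e => good e.1 e.2))
  -[X in (_ + X)%N]/(bad_count c) h addn0.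
Qed.

(** With length l and b bad arcs the weight is at least (B - S)l + Bkb. If b > 0, this is at least
    (k + 1)B - S, too much because B > (k + 1)S. If b = 0, then k divides l, and l >= 2k would give
    at least 2k(B - S), too much because B > 3S. The choice B = (2k + 2)S + 1 meets both
    requirements. *)
Lemma light_cycle c : dicycle G c ->
  cycle_weight reweighted c <= B *+ k + S *+ k ->
  simple_kcycle G k c /\ cycle_weight reweighted c = cycle_weight G c + B *+ k.
Proof.
move=> hc; have S0 := S_ge0 hc; have := cycle_weight_le hc.
rewrite cycle_weight_reweighted // => hw hle.
have c0 : c != [::] by case/andP: hc.
have sz : (0 < size c)%N by case: (c) c0.
have B0 : 0 < B by have := mulrn_wge0 (2 * k + 2) S0; lia.
have hBk : B *+ (2 * k) = B *+ k + B *+ k by rewrite mul2n -addnn mulrnDr.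
have hB1 : B = S *+ k + S *+ k + S + S + 1.
  by rewrite -hB mulrnDr mul2n -addnn mulrnDr mulr2n; lia.
have hSk : 0 <= S *+ k by exact: mulrn_wge0.
have hSB l : (0 < l)%N -> B - S <= B *+ l - S *+ l.
  case: l => // l _; rewrite !mulrS.
  have : S *+ l <= B *+ l by rewrite lerMn2r; apply/orP; right; lia.
  lia.
have b0 : bad_count c = 0%N.
  case: (posnP (bad_count c)) => // bp.
  have : B *+ k <= B *+ (k * bad_count c).
    by rewrite ler_wpMn2l // ?ltW // leq_pmulr.
  by have := hSB _ sz; lia.
have [/dvdnP[q hq] hu] := good_cycle c0 (good_cycleE b0).
rewrite b0 muln0 mulr0n addr0 in hle *.
have q1 : q = 1%N.
  case: q hq => [|[|q]] // hq; first by rewrite hq in sz.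
  have hl : (size c = 2 * k + q * k)%N by rewrite hq -mulnDl.
  have hqk : S *+ (q * k) <= B *+ (q * k) by rewrite lerMn2r; apply/orP; right; lia.
  have hB2 : B *+ size c = B *+ k + B *+ k + B *+ (q * k) by rewrite hl mulrnDr hBk.
  have hS2 : S *+ size c = S *+ k + S *+ k + S *+ (q * k).
    by rewrite hl mulrnDr mul2n -addnn mulrnDr.
  have hk3 : (S + S + S + 1) *+ k <= B *+ k.
    by rewrite lerMn2r; apply/orP; right; have : S <= S *+ k; [case: (k) k0 => // k' _; rewrite mulrS; have := mulrn_wge0 k' S0; lia | lia].
  have hk1 : 1 <= 1 *+ k :> int by rewrite natz; lia.
  by rewrite !mulrnDl in hk3; lia.
rewrite q1 mul1n in hq.
by rewrite /simple_kcycle hc hu // hq eqxx.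
Qed.

Lemma proper_cycle_light c : simple_kcycle G k c ->
  (forall i, (i < k)%N -> nth 0%N [seq col x | x <- c] i = i) ->
  cycle_weight reweighted c = cycle_weight G c + B *+ k.
Proof.
case/and3P=> hc _ /eqP sz hcol; rewrite cycle_weight_reweighted // sz.
suff -> : bad_count c = 0%N by rewrite muln0 mulr0n addr0.
apply/eqP; rewrite -leqn0 leqNgt -has_count -all_predC.
case: c sz hcol {hc} => [|x p] sz hcol; first by move: k0; rewrite -sz.
apply/(all_nthP (x, x)) => i; rewrite size1_zip ?size_rot // => hi /=.
rewrite negbK /good nth_zip ?size_rot //=.
have colE j : (j < k)%N -> col (nth x (x :: p) j) = j.
  by move=> hj; rewrite -[RHS]hcol // (nth_map x) ?sz.
rewrite colE -?sz // rot1_cons nth_rcons.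
case: ltnP => hip.
  by rewrite -[nth x p i]/(nth x (x :: p) i.+1) colE -?sz // modn_small.
have -> : i = size p by rewrite /= in hi; lia.
rewrite eqxx -[x]/(nth x (x :: p) 0) colE //= in sz *.
by rewrite sz modnn.
Qed.

Lemma reweighted_no_negative : no_negative_cycle reweighted.
Proof.
move=> c; rewrite dicycle_reweighted => hc; have S0 := S_ge0 hc.
rewrite cycle_weight_reweighted //; have := cycle_weight_le hc.
have hSk : 0 <= S *+ (2 * k) by exact: mulrn_wge0.
have hle : S <= B by rewrite -hB mulrnDr mulr2n; lia.
have : S *+ size c <= B *+ size c by rewrite lerMn2r hle orbT.
have : 0 <= B *+ (k * bad_count c) by apply: mulrn_wge0; lia.
by lia.
Qed.

(** Soundness and completeness of one call: an answer below the threshold is a simple k-cycle, and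
    any properly coloured k-cycle forces the answer to have length k and to be no heavier. The
    reweighted weight exceeds the original one by Bk whatever the colouring, so results of different
    calls can be compared. *)
Lemma reweighted_answer c : min_weight_answer reweighted (dicycle reweighted) c ->
  (dicycle G c -> cycle_weight reweighted c <= B *+ k + S *+ k ->
     simple_kcycle G k c /\
     cycle_weight reweighted c = cycle_weight G c + B *+ k) /\
  (forall c', simple_kcycle G k c' ->
     (forall i, (i < k)%N -> nth 0%N [seq col x | x <- c'] i = i) ->
     [/\ dicycle G c, size c = k &
       cycle_weight reweighted c <= cycle_weight G c' + B *+ k]).
Proof.
move=> hc; split; first exact: light_cycle.
move=> c' hc' hcol; have hw := proper_cycle_light hc' hcol.
have [dc' uc' /eqP sc'] := and3P hc'.
have {hc} [dc hle] : dicycle G c /\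
    cycle_weight reweighted c <= cycle_weight G c' + B *+ k.
  rewrite -hw; case: c hc => [h|x c [h1 h2]].
    by have := h c'; rewrite dicycle_reweighted dc'.
  by rewrite -dicycle_reweighted; split=> //; apply: h2; rewrite dicycle_reweighted.
split=> //; have := cycle_weight_le dc'; rewrite sc' => hle'.
by have [|/and3P[_ _ /eqP]] := light_cycle dc; first by lia.
Qed.

End Reweight.

(** * Simulating a program on a memory that is cleared in constant time *)

(* vL bounds the entries of a seed, vCUR is the current stamp, vS the sum of the
   absolute weights, vB and vBK the penalties of good and bad arcs, vBEST the
   least reweighted weight of a k-cycle found so far. *)
Local Notation vN := 0%N (only parsing).
Local Notation vM := 1%N (only parsing).
Local Notation vL := 2%N (only parsing).
Local Notation vCUR := 3%N (only parsing).
Local Notation vS := 4%N (only parsing).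
Local Notation vB := 5%N (only parsing).
Local Notation vBK := 6%N (only parsing).
Local Notation vBEST := 7%N (only parsing).
Local Notation vPC := 8%N (only parsing).
Local Notation vHALT := 9%N (only parsing).
Local Notation vTMP := 10%N (only parsing).
Local Notation vI := 11%N (only parsing).
Local Notation vADDR := 12%N (only parsing).
Local Notation vX := 13%N (only parsing).
Local Notation vT := 14%N (only parsing).
Local Notation vF := 15%N (only parsing).
Local Notation vACC := 16%N (only parsing).
Local Notation vCU := 17%N (only parsing).
Local Notation vW := 19%N (only parsing).
Local Notation vPOW := 20%N (only parsing).
Local Notation vV := 21%N (only parsing).
Local Notation vC := 22%N (only parsing).

Section Simulation.
Local Open Scope ring_scope.

(* A simulated cell holds 0 unless its stamp is current, so that incrementing
   the current stamp clears the simulated memory. *)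
Definition sim_mem (s : store) : memory :=
  fun x => if 0 < var s vCUR - arr s AStamp x then 0 else arr s AVal x.

Definition sim_get (e : expr) : expr :=
  EIf (ESub (EVar vCUR) (EArr AStamp e)) (EConst 0) (EArr AVal e).

Definition sim_set (a e : expr) : cmd :=
  Cat (SetA AVal a e) (SetA AStamp a (EVar vCUR)).

Definition next : cmd := Set_ vPC (EAdd (EVar vPC) (EConst 1)).

Definition sim_instr (i : instr) : cmd :=
  match i with
  | Const a z => Cat (sim_set (EConst a) (EConst z)) next
  | Add a b =>
      Cat (sim_set (EConst a)
             (EAdd (sim_get (EConst a)) (sim_get (EConst b)))) next
  | Defs.Sub a b =>
      Cat (sim_set (EConst a)
             (ESub (sim_get (EConst a)) (sim_get (EConst b)))) next
  | Fetch a b => Cat (sim_set (EConst a) (sim_get (sim_get (EConst b)))) next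
  | Store a b =>
      Cat (Set_ vTMP (sim_get (EConst a)))
        (Cat (sim_set (EVar vTMP) (sim_get (EConst b))) next)
  | JumpPos a l =>
      Set_ vPC (EIf (sim_get (EConst a)) (EConst l%:Z)
                  (EAdd (EVar vPC) (EConst 1)))
  | Halt => Set_ vHALT (EConst 1)
  end.

(** Positions are tested in increasing order, so the first i for which the program counter is not
    larger equals it. The cost depends only on [p], hence a simulated step takes constant time. *)
Fixpoint dispatch (i : nat) (p : program) : cmd :=
  if p is ins :: p' then
    If_ (ESub (EVar vPC) (EConst i%:Z)) (dispatch i.+1 p') (sim_instr ins)
  else Set_ vHALT (EConst 1).

Definition simulate (p : program) : cmd :=
  While (ESub (EConst 1) (EVar vHALT)) (dispatch 0 p).

(** No stamp lies in the future; this is what makes all stamps obsolete when the current one is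
    incremented. *)
Definition stamps_ok (s : store) : Prop :=
  forall x, arr s AStamp x <= var s vCUR.

Lemma lf_dispatch i p q s : var s vPC = (i + q)%N%:Z ->
  lf (dispatch i p) s = lf (sim_instr (nth Halt p q)) s.
Proof.
elim: p i q => [|ins p ih] i q h /=; first by rewrite nth_nil.
rewrite h; case: q h => [|q] h /=; first by rewrite addn0 subrr.
rewrite -addSnnS in h *; rewrite ifT; first exact: ih.
by lia.
Qed.

Lemma loopfree_dispatch i p : loopfree (dispatch i p).
Proof.
by elim: p i => //= ins p ih i; rewrite ih; case: ins.
Qed.

Lemma writes_var_dispatch i p x :
  x \notin [:: vPC; vHALT; vTMP] -> writes_var (dispatch i p) x = false.
Proof.
rewrite !inE !negb_or => /and3P[h1 h2 h3].
elim: p i => [|ins p ih] i /=; first by rewrite eqnE (negbTE h2).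
by rewrite ih; case: ins => * /=; rewrite !eqnE ?(negbTE h1) ?(negbTE h2) ?(negbTE h3).
Qed.

Lemma writes_arr_dispatch i p A :
  writes_arr (dispatch i p) A -> A = AVal \/ A = AStamp.
Proof.
elim: p i => //= ins p ih i /orP[/ih //|].
by case: ins {ih}; case: A => //=; auto.
Qed.

Lemma sim_mem_set s a z x :
  sim_mem (seta (seta s AVal a z) AStamp a (var s vCUR)) x =
  update (sim_mem s) a z x.
Proof.
rewrite /sim_mem /update /=.
by case: eqP => _ //=; rewrite subrr.
Qed.

Lemma stamps_ok_set s a z :
  stamps_ok s -> stamps_ok (seta (seta s AVal a z) AStamp a (var s vCUR)).
Proof. by move=> h x /=; case: eqP. Qed.

Lemma sim_step p pc s M s' :
  s' = lf (sim_instr (nth Halt p pc)) s ->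
  sim_mem s =1 M -> var s vPC = pc%:Z -> var s vHALT = 0 -> stamps_ok s ->
  stamps_ok s' /\
  if step p pc M is Some (pc', M') then
    [/\ sim_mem s' =1 M', var s' vPC = pc'%:Z & var s' vHALT = 0]
  else sim_mem s' =1 M /\ var s' vHALT = 1.
Proof.
move=> -> hM hpc hh hs; rewrite /step.
have upd a z z' : z = z' -> update (sim_mem s) a z =1 update M a z'.
  by move=> -> x; rewrite /update hM.
case: (nth Halt p pc) => [a z|a b|a b|a b|a b|a l|] /=.
- split; first exact: stamps_ok_set.
  by split=> //; [move=> x; apply: etrans (sim_mem_set s a z x) _; exact: upd | rewrite hpc -addn1].
- split; first exact: stamps_ok_set.
  split=> //; last by rewrite hpc -addn1.
  by move=> x; apply: etrans (sim_mem_set s a _ x) _; apply: upd; rewrite -!hM.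
- split; first exact: stamps_ok_set.
  split=> //; last by rewrite hpc -addn1.
  by move=> x; apply: etrans (sim_mem_set s a _ x) _; apply: upd; rewrite -!hM.
- split; first exact: stamps_ok_set.
  split=> //; last by rewrite hpc -addn1.
  by move=> x; apply: etrans (sim_mem_set s a _ x) _; apply: upd; rewrite -!hM.
- split; first by move=> x /=; case: eqP.
  split=> //; last by rewrite hpc -addn1.
  move=> x; rewrite -!hM; apply: etrans (sim_mem_set s (sim_mem s a) _ x) _.
  exact: upd.
- split; first by [].
  split=> //; rewrite hpc -(hM a) -/(sim_mem s a).
  by case: (0 < _) => //; rewrite -addn1.
- by split.
Qed.

Definition sim_time (p : program) (t : nat) : nat :=
  (t * (ecost (ESub (EConst 1) (EVar vHALT)) + cost (dispatch 0 p) + 3) +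
   (ecost (ESub (EConst 1) (EVar vHALT)) + 3))%N.

Lemma simulate_correct p t pc s M Mf :
  run p t pc M = Some Mf -> sim_mem s =1 M -> var s vPC = pc%:Z ->
  var s vHALT = 0 -> stamps_ok s ->
  runs (simulate p) (sim_time p t) s
    (fun s' => sim_mem s' =1 Mf /\ stamps_ok s').
Proof.
elim: t pc s M => //= t ih pc s M hrun hM hpc hh hs.
have hd : runs (dispatch 0 p) (cost (dispatch 0 p)) s (eq (lf (dispatch 0 p) s)).
  by apply: runs_lf => //; exact: loopfree_dispatch.
have [t1 [s1 [le1 ex1 e1]]] := hd.
rewrite (@lf_dispatch _ _ pc) ?add0n // in e1.
have [hs1 h1] := sim_step (esym e1) hM hpc hh hs.
have pos : 0 < eval s (ESub (EConst 1) (EVar vHALT)) by rewrite /= hh.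
move: hrun h1; case: (step p pc M) => [[pc' M'] hrun [hM1 hpc1 hh1]|[<-] [hM1 hh1]].
  have [t2 [s2 [le2 ex2 q2]]] := ih _ _ _ hrun hM1 hpc1 hh1 hs1.
  exists (ecost (ESub (EConst 1%R) (EVar vHALT)) + t1 + t2 + 3)%N, s2; split=> //.
    by rewrite /sim_time /= in le2 *; lia.
  exact: exec_while ex1 ex2.
exists (ecost (ESub (EConst 1%R) (EVar vHALT)) + t1 +
  (ecost (ESub (EConst 1%R) (EVar vHALT)) + 3) + 3)%N, s1; split=> //.
  by rewrite /sim_time mulSn; lia.
apply: exec_while ex1 _ => //.
by apply: exec_while_end; rewrite /= hh1.
Qed.

End Simulation.

(** * The reduction as a program *)

Section Combinators.
Local Open Scope ring_scope.

Lemma frame_refl c s : frame c s s.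
Proof. by []. Qed.

Lemma frame_trans c s1 s2 s3 : frame c s1 s2 -> frame c s2 s3 -> frame c s1 s3.
Proof.
by move=> [v1 a1] [v2 a2]; split=> [x|A] h; rewrite ?v2 ?v1 ?a2 ?a1.
Qed.

Lemma frame_sub c d s s' :
  (forall x, writes_var c x -> writes_var d x) ->
  (forall A, writes_arr c A -> writes_arr d A) -> frame c s s' -> frame d s s'.
Proof.
move=> hv ha [v a]; split=> [x|A] h.
  by apply: v; apply: contra h; exact: hv.
by apply: a; apply: contra h; exact: ha.
Qed.

Lemma runs_cat_frame c d t1 t2 s (Q R : store -> Prop) :
  runs c t1 s Q -> (forall s', Q s' -> frame c s s' -> runs d t2 s' R) ->
  runs (Cat c d) (t1 + t2) s R.
Proof. by move=> /runs_frame hc hd; apply: runs_cat hc _ => s' [q f]; exact: hd. Qed.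

Lemma runs_lf_cat c d t s (R : store -> Prop) :
  loopfree c -> runs d t (lf c s) R -> runs (Cat c d) (cost c + t) s R.
Proof.
move=> hc hd; apply: (runs_cat (Q := eq (lf c s))); first exact: runs_lf.
by move=> s' <-.
Qed.

(** The frame relative to the start of the loop is carried along automatically, so loop invariants
    need not list unchanged variables. *)
Lemma runs_for_frame e c t (I : nat -> store -> Prop) N s :
  I 0%N s ->
  (forall i s', (i < N)%N -> I i s' -> frame c s s' ->
    0 < eval s' e /\ runs c t s' (I i.+1)) ->
  (forall s', I N s' -> frame c s s' -> ~~ (0 < eval s' e)) ->
  runs (While e c) (N * (ecost e + t + 3) + (ecost e + 3)) s
    (fun s' => I N s' /\ frame c s s').
Proof.
move=> h0 hs hN.
apply: (runs_for (I := fun i s' => I i s' /\ frame c s s')).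
- by split=> //; exact: frame_refl.
- move=> i s' hi [hI hf]; have [pos hr] := hs i s' hi hI hf; split=> //.
  apply: runs_conseq (runs_frame hr) => // s2 [q f]; split=> //.
  exact: frame_trans f.
- by move=> s' [hI hf]; exact: hN.
Qed.

(** As k is a constant, iterations over colours and cycle positions are unrolled, and the index
    becomes a literal of the code. *)
Fixpoint iter_cmd (c : nat -> cmd) (k : nat) : cmd :=
  if k is k'.+1 then Cat (iter_cmd c k') (c k') else Skip.

Lemma writes_var_iter c k x :
  (forall i, writes_var (c i) x = false) -> writes_var (iter_cmd c k) x = false.
Proof. by move=> h; elim: k => //= k ->; rewrite h. Qed.

Lemma writes_arr_iter c k A :
  (forall i, writes_arr (c i) A = false) -> writes_arr (iter_cmd c k) A = false.
Proof. by move=> h; elim: k => //= k ->; rewrite h. Qed.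

Lemma runs_iter c t (I : nat -> store -> Prop) k s :
  I 0%N s ->
  (forall i s', (i < k)%N -> I i s' -> frame (iter_cmd c k) s s' ->
    runs (c i) t s' (I i.+1)) ->
  runs (iter_cmd c k) (k * t) s
    (fun s' => I k s' /\ frame (iter_cmd c k) s s').
Proof.
move=> h0; elim: k => [|k ih] hs /=.
  by exists 0%N, s; split=> //; constructor.
rewrite mulSnr; apply: runs_conseq (leqnn _) _ (runs_frame _); first by move=> s' h; exact: h.
apply: runs_cat_frame.
  apply: ih => i s' hi hI hf; apply: hs => //; first by lia.
  by apply: frame_sub hf => [x|A] /= ->.
move=> s' [hI hf] _; apply: hs => //.
by apply: frame_sub hf => [x|A] /= ->.
Qed.

End Combinators.

(** * Computing the colour of a node *)

Section ColourProgram.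
Local Open Scope ring_scope.
Variables (k : nat).

Definition digit_pre (t : nat) : cmd :=
  Cat (Set_ vX (EVar vV))
    (Cat (Set_ vT (EArr ASeed (EConst t%:Z))) (Set_ vF (EConst 0))).

Definition twice_x : expr := EAdd (EVar vX) (EVar vX).

(** Positive exactly when n <= 2x; the 1 turns the strict test of the machine into a weak one. *)
Definition overflow : expr := EAdd (ESub twice_x (EVar vN)) (EConst 1).

Definition digit_body : cmd :=
  Cat (Set_ vF (EIf overflow (EConst 1) (EConst 0)))
    (Cat (Set_ vX (EIf overflow (ESub twice_x (EVar vN)) twice_x))
       (Set_ vT (ESub (EVar vT) (EConst 1)))).

Definition digit_loop : cmd := While (EVar vT) digit_body.

Definition digit_post (t : nat) : cmd :=
  Set_ vACC (EAdd (EVar vACC)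
    (EIf (ESub (EArr ASeed (EConst t%:Z)) (EConst 1))
       (ESub (EConst 1) (EVar vF)) (EVar vF))).

Definition pass_cmd (i j : nat) : cmd :=
  Cat (digit_pre (2 * (i * k + j)))
    (Cat digit_loop (digit_post (2 * (i * k + j) + 1))).

Definition row_cmd (i : nat) : cmd :=
  Cat (Set_ vACC (EConst 0))
    (Cat (iter_cmd (pass_cmd i) k)
       (Set_ vC (EIf (ESub (EVar vACC) (EConst (k%:Z - 1)))
                   (EConst i%:Z) (EVar vC)))).

Definition colour_cmd : cmd := Cat (Set_ vC (EConst 0)) (iter_cmd row_cmd k).

Lemma writes_var_colour x :
  x \notin [:: vX; vT; vF; vACC; vC] -> writes_var colour_cmd x = false.
Proof.
rewrite !inE !negb_or => /and5P[/negbTE h1 /negbTE h2 /negbTE h3 /negbTE h4 /negbTE h5].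
rewrite /colour_cmd /= writes_var_iter ?orbF ?eqnE // => i.
by rewrite /row_cmd /= writes_var_iter /= ?eqnE ?h4 ?h5 // => j; rewrite /= ?eqnE ?h1 ?h2 ?h3 ?h4.
Qed.

Lemma writes_arr_colour A : writes_arr colour_cmd A = false.
Proof.
by rewrite /colour_cmd /= writes_arr_iter // => i; rewrite /row_cmd /= writes_arr_iter.
Qed.

(** Each round overwrites vF with the overflow of the doubling it performs, so after r > 0 rounds vF
    is digit number r. *)
Lemma digit_loop_correct n v b s :
  (v < n)%N -> var s vN = n%:Z -> var s vX = v%:Z -> var s vT = b%:Z ->
  var s vF = 0 ->
  runs digit_loop (b * (ecost (EVar vT) + cost digit_body + 3) + (ecost (EVar vT) + 3))
    s (fun s' => var s' vF = ((0 < b)%N && digit n b v)%:Z /\ frame digit_body s s').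
Proof.
move=> hv hN hX hT hF.
pose I r s' := [/\ var s' vX = (iter r (double_mod n) v)%:Z,
  var s' vT = b%:Z - r%:Z & var s' vF = ((0 < r)%N && digit n r v)%:Z].
apply: (runs_conseq (Q := fun s' => I b s' /\ frame digit_body s s')) (leqnn _) _ _.
  by move=> s' [[_ _ ->] hf].
apply: runs_for_frame.
- by split=> //=; rewrite ?subr0.
- move=> r s' hr [h1 h2 h3] hf; split; first by rewrite /= h2; lia.
  apply: runs_lf => //.
  have hN' : var s' vN = n%:Z by rewrite -hN; apply: (proj1 hf).
  split=> /=; rewrite ?h1 ?hN' ?h2; [|lia|].
  + move: (iter r _ v) => x; rewrite /double_mod.
    by case: leqP => h; case: ifP; lia.
  + by rewrite /digit /=; case: leqP => h; case: ifP => // h'; lia.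
- by move=> s' [_ h2 _] _ /=; rewrite h2 subrr.
Qed.

(** The index 0 stands for every index, since the cost of a literal does not depend on its value. *)
Definition pass_time (L : nat) : nat :=
  (cost (digit_pre 0) + ((L * (ecost (EVar vT) + cost digit_body + 3) +
    (ecost (EVar vT) + 3)) + cost (digit_post 0)))%N.

Variables (n L : nat) (f : nat -> nat).

Definition seeded (s : store) : Prop :=
  forall t : nat, (t < 2 * (k * k))%N ->
    arr s ASeed t%:Z = (f t)%:Z /\ (0 < f t <= L)%N.

Lemma pass_correct v i j a s :
  (v < n)%N -> (i < k)%N -> (j < k)%N -> var s vN = n%:Z -> var s vV = v%:Z ->
  var s vACC = a%:Z -> seeded s ->
  runs (pass_cmd i j) (pass_time L) s
    (fun s' => var s' vACC = (a + pass k n f v i j)%:Z).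
Proof.
move=> hv hi hj hN hV hA hs.
have lt : (i * k + j < k * k)%N.
  by apply: (@leq_trans (i.+1 * k)); [rewrite mulSn; lia | rewrite leq_mul2r hi orbT].
have [e1 b1] := hs (2 * (i * k + j))%N ltac:(lia).
have [e2 b2] := hs (2 * (i * k + j) + 1)%N ltac:(lia).
rewrite /pass_cmd /pass_time; apply: runs_lf_cat => //.
set s1 := lf _ s.
apply: (runs_cat (Q := fun s' => var s' vF = (digit n (f (2 * (i * k + j))) v)%:Z /\
    frame digit_body s1 s')).
  apply: runs_conseq (digit_loop_correct (n := n) (v := v) (b := f (2 * (i * k + j))%N) _ _ _ _ _) => //.
  - by rewrite leq_add2r leq_mul2r; apply/orP; right; lia.
  - by move=> s' [-> h]; case/andP: b1 => ->.
move=> s' [hF [hfv hfa]]; apply: runs_lf => //=.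
rewrite hfv // hfa // hF /= hA e2 /pass.
by case: (digit _ _ _); case: ltnP => h /=; case: ifP => h' /=; lia.
Qed.

Definition row_time : nat :=
  (cost (Set_ vACC (EConst 0%R)) + (k * pass_time L +
   cost (Set_ vC (EIf (ESub (EVar vACC) (EConst 0%R)) (EConst 0%R) (EVar vC)))))%N.

Definition colour_time : nat := (cost (Set_ vC (EConst 0%R)) + k * row_time)%N.

(** Within a row vACC counts the tests passed; it exceeds k - 1 exactly when all k of them are. *)
Lemma colour_correct v s :
  (v < n)%N -> var s vN = n%:Z -> var s vV = v%:Z -> seeded s ->
  runs colour_cmd colour_time s (fun s' => var s' vC = (colour k n f v)%:Z).
Proof.
move=> hv hN hV hs; apply: runs_lf_cat => //; set s1 := lf _ s.
pose I i (s' : store) := var s' vC = (foldl (fun acc i =>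
  if all (pass k n f v i) (iota 0 k) then i else acc) 0%N (iota 0 i))%:Z.
apply: (runs_conseq (Q := fun s' => I k s' /\ frame (iter_cmd row_cmd k) s1 s')) (leqnn _) _ _.
  by move=> s' [].
have wv x : x \notin [:: vX; vT; vF; vACC; vC] -> ~~ writes_var (iter_cmd row_cmd k) x.
  by move=> hx; have := writes_var_colour hx; rewrite /colour_cmd /= => /norP[].
apply: runs_iter => // i s2 hi hI [hfv hfa].
have wa A : ~~ writes_arr (iter_cmd row_cmd k) A.
  by have := writes_arr_colour A; rewrite /colour_cmd /= => ->.
have hN2 : var s2 vN = n%:Z by rewrite hfv ?wv.
have hV2 : var s2 vV = v%:Z by rewrite hfv ?wv.
have hs2 : seeded s2 by move=> t ht; rewrite hfa ?wa //; exact: hs.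
rewrite /row_cmd /row_time; apply: runs_lf_cat => //; set s3 := lf _ s2.
pose J j (s' : store) := var s' vACC = (count (pass k n f v i) (iota 0 j))%:Z.
apply: (runs_cat (runs_iter (I := J) (k := k) (t := pass_time L) _ _)) => //.
  move=> j s4 hj hJ [hfv' hfa'].
  have wv' x : x \notin [:: vX; vT; vF; vACC] -> writes_var (iter_cmd (pass_cmd i) k) x = false.
    rewrite !inE !negb_or => /and4P[/negbTE h1 /negbTE h2 /negbTE h3 /negbTE h4].
    by apply: writes_var_iter => l; rewrite /= ?eqnE ?h1 ?h2 ?h3 ?h4.
  apply: (runs_conseq (Q := _) (leqnn _) _ (pass_correct (v := v) (a := count (pass k n f v i) (iota 0 j)) _ _ _ _ _ _ _)) => //.
  - move=> s5 h5; rewrite /J h5 -addn1 iotaD count_cat add0n /= addn0.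
    by [].
  - by rewrite hfv' ?wv'.
  - by rewrite hfv' ?wv'.
  - by move=> t ht; rewrite hfa' ?writes_arr_iter //; exact: hs2.
move=> s4 [hJ [hfv' hfa']]; apply: runs_lf => //=.
have ei : iota 0 i.+1 = iota 0 i ++ [:: i] by rewrite -addn1 iotaD.
rewrite hJ /I ei foldl_cat /=.
have -> : var s4 vC = var s2 vC.
  by rewrite hfv' // writes_var_iter.
rewrite hI all_count size_iota.
have := count_size (pass k n f v i) (iota 0 k); rewrite size_iota => hle.
by case: eqP => h; case: ifP => h' //; lia.
Qed.

End ColourProgram.

Section InputCells.
Local Open Scope ring_scope.
Variables (n m : nat) (G : wdigraph n m).

Lemma input_arc (i : 'I_m) :
  [/\ input G (3 * i).+2%:Z = (nat_of_ord (tnth (arcs G) i).1.1)%:Z,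
      input G (3 * i + 1).+2%:Z = (nat_of_ord (tnth (arcs G) i).1.2)%:Z &
      input G (3 * i + 2).+2%:Z = (tnth (arcs G) i).2].
Proof.
rewrite /input /encode /=.
have [-> -> ->] := @nth_triples _ (fun a : 'I_n * 'I_n * int => (nat_of_ord a.1.1)%:Z)
  (fun a => (nat_of_ord a.1.2)%:Z) (fun a => a.2) (arcs G) i.
have sz : (i < size (arcs G))%N by rewrite size_tuple.
rewrite !(nth_map (tnth (arcs G) i) _ _ sz).
by rewrite -!tnth_nth.
Qed.

(** Cells that are not rewritten for a call read as 0 in the simulation, which has to match the true
    input there. *)
Lemma input_beyond (x : int) : (2 + 3 * m)%N%:Z <= x -> input G x = 0.
Proof.
case: x => // j hj; apply: nth_default.
rewrite /encode /= size_flatten /shape -map_comp.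
have -> : [seq (size \o (fun a : 'I_n * 'I_n * int =>
    [:: (nat_of_ord a.1.1)%:Z; (nat_of_ord a.1.2)%:Z; a.2])) i | i <- arcs G] = nseq m 3.
  rewrite -[m in RHS](size_tuple (arcs G)); by elim: (tval _) => //= a s ->.
by rewrite sumn_nseq; lia.
Qed.

End InputCells.

Arguments colour_cmd : simpl never.

(** * One call of the shortest cycle algorithm for one colouring *)

Section BodyProgram.
Local Open Scope ring_scope.
Variables (k : nat).

Definition eqe (a b : expr) : expr :=
  EIf (ESub a b) (EConst 0) (EIf (ESub b a) (EConst 0) (EConst 1)).

Lemma eval_eqe s a b : eval s (eqe a b) = (eval s a == eval s b)%:Z.
Proof.
by rewrite /=; case: ifP; case: eqP => [->|h1] h2; rewrite ?subrr //; last case: ifP; lia.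
Qed.

Definition addr_plus (d : nat) : expr := EAdd (EVar vADDR) (EConst d%:Z).

Definition advance : cmd :=
  Cat (Set_ vADDR (addr_plus 3)) (Set_ vI (EAdd (EVar vI) (EConst 1))).

Definition start_scan : cmd := Cat (Set_ vI (EConst 0)) (Set_ vADDR (EConst 2)).

Definition more_arcs : expr := ESub (EVar vM) (EVar vI).

(** For colours below k, an arc is good exactly when the colour difference is 1 or 1 - k; this
    avoids computing a remainder. *)
Definition new_weight : expr :=
  EAdd (EArr AIn (addr_plus 2))
    (EIf (EAdd (eqe (ESub (EVar vC) (EVar vCU)) (EConst 1))
               (eqe (ESub (EVar vC) (EVar vCU)) (EConst (1 - k%:Z))))
       (EVar vB) (EVar vBK)).

(** The weight is stored twice: the simulated program may overwrite its input, and the copy in [AWt]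
    serves to weigh its answer afterwards. *)
Definition build_store : cmd :=
  Cat (sim_set (addr_plus 0) (EArr AIn (addr_plus 0)))
  (Cat (sim_set (addr_plus 1) (EArr AIn (addr_plus 1)))
  (Cat (sim_set (addr_plus 2) (EVar vW))
  (Cat (SetA AWt (EVar vI) (EVar vW)) advance))).

Definition build_mid : cmd :=
  Cat (Set_ vCU (EVar vC)) (Set_ vV (EArr AIn (addr_plus 1))).

Definition build_body : cmd :=
  Cat (Set_ vV (EArr AIn (addr_plus 0)))
  (Cat (colour_cmd k)
  (Cat build_mid (Cat (colour_cmd k) (Cat (Set_ vW new_weight) build_store)))).

Definition build_pre : cmd :=
  Cat (Set_ vCUR (EAdd (EVar vCUR) (EConst 1)))
  (Cat (sim_set (EConst 0) (EVar vN))
  (Cat (sim_set (EConst 1) (EVar vM)) start_scan)).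

Definition build : cmd := Cat build_pre (While more_arcs build_body).

Variables (n m : nat) (G : wdigraph n m) (L : nat) (f : nat -> nat) (B : int).
Hypothesis k0 : (0 < k)%N.

Let col (u : 'I_n) : nat := colour k n f u.
Let G' := reweighted G k col B.

Definition base (s : store) : Prop :=
  [/\ var s vN = n%:Z, var s vM = m%:Z, var s vB = B, var s vBK = B *+ k.+1 &
      forall i : nat, arr s AIn i%:Z = input G i%:Z].

Lemma base_frame c s s' :
  frame c s s' -> base s ->
  ~~ [|| writes_var c vN, writes_var c vM, writes_var c vB, writes_var c vBK
       | writes_arr c AIn] -> base s'.
Proof.
move=> [hv ha] [h1 h2 h3 h4 h5]; rewrite !negb_or => /and5P[w1 w2 w3 w4 w5].
by split=> [||||i]; rewrite ?hv ?ha.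
Qed.

Definition build_body_time : nat :=
  (cost (Set_ vV (EArr AIn (addr_plus 0))) + (colour_time k L +
   (cost build_mid + (colour_time k L +
     (cost (Set_ vW new_weight) + cost build_store)))))%N.

Definition build_inv (i : nat) (s : store) : Prop :=
  [/\ var s vI = i%:Z, var s vADDR = (2 + 3 * i)%N%:Z, stamps_ok s,
      forall x, sim_mem s x = if x < (2 + 3 * i)%N%:Z then input G' x else 0 &
      forall j : 'I_m, (j < i)%N -> arr s AWt (nat_of_ord j)%:Z = (tnth (arcs G') j).2].

Lemma build_body_correct (i : 'I_m) s :
  base s -> seeded k L f s -> build_inv i s ->
  runs build_body build_body_time s (build_inv i.+1).
Proof.
move=> hb hs [hI hA hst hsim hW].
have [e0 e1 e2] := input_arc G i; have [e0' e1' e2'] := input_arc G' i.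
have [hN hM hB hBK hIn] := hb.
set a := tnth (arcs G) i in e0 e1 e2.
have ea' : tnth (arcs G') i = (a.1, a.2 + penalty k col B a.1.1 a.1.2).
  by rewrite /= tnth_map.
rewrite ea' in e0' e1' e2'; cbn [fst snd] in e0', e1', e2'.
apply: runs_lf_cat => //; set s1 := lf _ s.
have v1 : var s1 vV = (nat_of_ord a.1.1)%:Z.
  by rewrite /s1 /= addr0 hA -[(2 + 3 * i)%N]/((3 * i).+2) hIn.
have wv := @writes_var_colour k; have wa := @writes_arr_colour k.
apply: (runs_cat_frame (colour_correct (n := n) (v := a.1.1) (f := f) _ _ _ _)) => //.
move=> s2 hC2 [fv2 fa2]; apply: runs_lf_cat => //; set s3 := lf _ s2.
have vA2 : var s2 vADDR = (2 + 3 * i)%N%:Z by rewrite fv2 ?wv.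
have v3 : var s3 vV = (nat_of_ord a.1.2)%:Z.
  rewrite /s3 /= vA2 fa2 ?wa // -e1 -hIn /=; congr (arr s AIn _); lia.
apply: (runs_cat_frame (colour_correct (n := n) (v := a.1.2) (f := f) _ _ _ _)) => //.
- by rewrite /s3 /= fv2 ?wv.
- by move=> t ht; rewrite /s3 /= fa2 ?wa //; exact: hs.
move=> s4 hC4 [fv4 fa4].
have vA4 : var s4 vADDR = (2 + 3 * i)%N%:Z by rewrite fv4 ?wv.
have vI4 : var s4 vI = i%:Z by rewrite fv4 ?wv // /s3 /= fv2 ?wv.
have vCU4 : var s4 vCU = (col a.1.1)%:Z by rewrite fv4 ?wv // /s3 /= hC2.
have vB4 : var s4 vB = B by rewrite fv4 ?wv // /s3 /= fv2 ?wv.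
have vBK4 : var s4 vBK = B *+ k.+1 by rewrite fv4 ?wv // /s3 /= fv2 ?wv.
have aE A : arr s4 A = arr s A by rewrite fa4 ?wa // /s3 /= fa2 ?wa.
have vCUR4 : var s4 vCUR = var s vCUR by rewrite fv4 ?wv // /s3 /= fv2 ?wv.
have vW4 : eval s4 new_weight = a.2 + penalty k col B a.1.1 a.1.2.
  rewrite /new_weight; cbn [eval]; rewrite !eval_eqe; cbn [eval addr_plus]; rewrite vA4 hC4 vCU4 vB4 vBK4 aE.
  congr (_ + _).
    by rewrite -e2 -hIn; congr (arr s AIn _); lia.
  rewrite /penalty /good.
  have := colour_lt n f a.1.1 k0; have := colour_lt n f a.1.2 k0.
  rewrite -/(col a.1.1) -/(col a.1.2).
  move: (col a.1.1) (col a.1.2) => x y hy hx.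
  have -> : (y == x.+1 %% k)%N = (y%:Z - x%:Z == 1) || (y%:Z - x%:Z == 1 - k%:Z).
    case: (ltnP x.+1 k) => hxk; first by rewrite modn_small //; lia.
    have -> : (x.+1 = k)%N by lia.
    by rewrite modnn; lia.
  by case: (y%:Z - x%:Z == 1); case: (y%:Z - x%:Z == 1 - k%:Z).
apply: runs_lf_cat => //; apply: runs_lf => //.
rewrite -[lf (Set_ _ _) _]/(setv s4 vW (eval s4 new_weight)) vW4; set w := a.2 + _ in e2' *.
set s5 := lf _ _.
have A0 : 2 + 3 * i%:Z = (3 * i).+2%:Z by lia.
have A1 : (2 + 3 * i)%N%:Z + 1 = (3 * i + 1).+2%:Z by lia.
have A2 : (2 + 3 * i)%N%:Z + 2 = (3 * i + 2).+2%:Z by lia.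
split.
- by rewrite /s5 /= vI4; lia.
- by rewrite /s5 /= vA4; lia.
- move=> x; rewrite /s5 /=; do 3!(case: eqP => // _).
  by rewrite vCUR4 aE; exact: hst.
- move=> x; rewrite /sim_mem /s5 /= !aE !vA4 vCUR4 addr0.
  have hx := hsim x; rewrite /sim_mem in hx.
  rewrite A1 A2 -[(2 + 3 * i)%N]/((3 * i).+2) !hIn e0 e1.
  case: (x =P (3 * i + 2).+2%:Z) => [->|n2].
    by rewrite subrr ltxx e2' ifT //; lia.
  case: (x =P (3 * i + 1).+2%:Z) => [->|n1].
    by rewrite subrr ltxx e1' ifT //; lia.
  case: (x =P (3 * i).+2%:Z) => [->|n0'].
    by rewrite subrr ltxx e0' ifT //; lia.
  by rewrite hx; case: ifP => h; case: ifP => h' //; lia.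
- move=> j hj; rewrite /s5 /= vI4 aE.
  case: eqP => [[/val_inj ->]|ne]; first by rewrite ea'.
  apply: hW; lia.
Qed.

Definition scan_time (t : nat) : nat :=
  (m * (ecost more_arcs + t + 3) + (ecost more_arcs + 3))%N.

Definition build_time : nat := (cost build_pre + scan_time build_body_time)%N.

Lemma writes_var_build x :
  x \notin [:: vCUR; vI; vADDR; vX; vT; vF; vACC; vC; vCU; vV; vW] ->
  writes_var build x = false.
Proof.
move=> hx; have : x \notin [:: vX; vT; vF; vACC; vC].
  by apply: contra hx; move: (x); apply/allP.
move/(@writes_var_colour k) => hc; move: hx; rewrite !inE !negb_or.
rewrite /build /build_body; cbn [writes_var]; rewrite hc /= !eqnE.
by do 10!(case/andP => /negbTE h; rewrite ?{}h); move=> /negbTE h; rewrite ?{}h.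
Qed.

Lemma writes_arr_build A :
  writes_arr build A -> [\/ A = AVal, A = AStamp | A = AWt].
Proof.
rewrite /build /build_body; cbn [writes_arr]; rewrite writes_arr_colour.
by case: A => //= _; [constructor 1 | constructor 2 | constructor 3].
Qed.

Lemma build_correct s :
  base s -> seeded k L f s -> stamps_ok s ->
  runs build build_time s (fun s' => [/\ sim_mem s' =1 input G', stamps_ok s' &
    forall j : 'I_m, arr s' AWt (nat_of_ord j)%:Z = (tnth (arcs G') j).2]).
Proof.
move=> hb hs hst; apply: runs_lf_cat => //; set s1 := lf _ s.
have hb1 : base s1 by case: hb.
have nwv x : x \notin [:: vCUR; vI; vADDR; vX; vT; vF; vACC; vC; vCU; vV; vW] ->
    ~~ writes_var build_body x.
  by move/writes_var_build; rewrite /build; cbn [writes_var]; case/norP.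
have nwa A : A <> AVal -> A <> AStamp -> A <> AWt -> ~~ writes_arr build_body A.
  move=> h1 h2 h3; apply/negP => h.
  by have [] : [\/ A = AVal, A = AStamp | A = AWt];
    [apply: writes_arr_build; rewrite /build; cbn [writes_arr]; rewrite h orbT|..].
apply: (runs_conseq (Q := fun s' => build_inv m s' /\ frame build_body s1 s')) (leqnn _) _ _.
  move=> s' [[_ _ hst' hsim hW] _]; split=> // [x|j]; last exact: hW.
  by rewrite hsim; case: ltP => // h; rewrite input_beyond.
apply: runs_for_frame.
- split=> // [x|x].
    by rewrite /s1 /=; do 2!(case: eqP => // _); have := hst x; lia.
  rewrite /sim_mem /s1 /=; have [hN hM _ _ _] := hb.
  case: (x =P 1) => [->|n1]; first by rewrite subrr ltxx hM.
  case: (x =P 0) => [->|n0]; first by rewrite subrr ltxx hN.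
  rewrite ifT; last by have := hst x; lia.
  by case: x n1 n0 => // -[|[|]].
- move=> i s' hi hI hf; split.
    have [hI1 _ _ _ _] := hI; rewrite /= hI1.
    have -> : var s' vM = m%:Z by case: hb1 => _ <- _ _ _; rewrite (proj1 hf) ?nwv.
    by lia.
  have -> : i = nat_of_ord (Ordinal hi) by [].
  apply: build_body_correct => //.
    by apply: base_frame hf hb1 _; rewrite !(negbTE (nwv _ _)) ?(negbTE (nwa _ _ _ _)).
  by move=> t ht; rewrite (proj2 hf) ?nwa //; exact: hs.
- move=> s' [hI1 _ _ _ _] hf; rewrite /= hI1.
  have -> : var s' vM = m%:Z by case: hb1 => _ <- _ _ _; rewrite (proj1 hf) ?nwv.
  by rewrite subrr.
Qed.

(** The weight of an arc is looked up by a pass over all m arcs, which mirrors the sum in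
    [arc_weight] and fits into O(T). Entry j of the answer is in cell j + 1. *)
Definition scan_incr (j : nat) : expr :=
  EIf (ESub (EAdd (eqe (EArr AIn (addr_plus 0)) (sim_get (EConst j.+1%:Z)))
               (eqe (EArr AIn (addr_plus 1)) (sim_get (EConst (j.+1 %% k).+1%:Z))))
         (EConst 1))
    (EArr AWt (EVar vI)) (EConst 0).

Definition scan_body (j : nat) : cmd :=
  Cat (Set_ vACC (EAdd (EVar vACC) (scan_incr j))) advance.

Lemma eval_sim_get s e : eval s (sim_get e) = sim_mem s (eval s e).
Proof. by []. Qed.

Definition scan (j : nat) : cmd := Cat start_scan (While more_arcs (scan_body j)).

Definition copy (j : nat) : cmd := SetA AOut (EConst j%:Z) (sim_get (EConst j.+1%:Z)).

Definition record : cmd := Cat (Set_ vBEST (EVar vACC)) (iter_cmd copy k).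

(** Neither simplicity nor the colours are tested: vBEST never exceeds Bk + Sk + 1, so an answer of
    smaller weight is light, hence a simple k-cycle. Its weight must be recomputed because the
    algorithm returns only nodes. *)
Definition check : cmd :=
  If_ (eqe (sim_get (EConst 0)) (EConst k%:Z))
    (Cat (Set_ vACC (EConst 0))
      (Cat (iter_cmd scan k) (If_ (ESub (EVar vBEST) (EVar vACC)) record Skip)))
    Skip.

Lemma sim_mem_frame c s s' : frame c s s' ->
  ~~ [|| writes_var c vCUR, writes_arr c AVal | writes_arr c AStamp] ->
  sim_mem s' =1 sim_mem s.
Proof.
by move=> [hv ha]; rewrite !negb_or => /and3P[h1 h2 h3] x; rewrite /sim_mem hv // !ha.
Qed.

Definition one_scan_time : nat :=
  (cost start_scan + scan_time (cost (scan_body 0)))%N.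

Lemma scan_correct j u v acc s :
  base s -> (forall i : 'I_m, arr s AWt (nat_of_ord i)%:Z = (tnth (arcs G') i).2) ->
  sim_mem s j.+1%:Z = (nat_of_ord u)%:Z ->
  sim_mem s (j.+1 %% k).+1%:Z = (nat_of_ord v)%:Z -> var s vACC = acc ->
  runs (scan j) one_scan_time s (fun s' => var s' vACC = acc + arc_weight G' u v).
Proof.
move=> hb hW hu hv hacc; apply: runs_lf_cat => //; set s1 := lf _ s.
have hb1 : base s1 by case: hb.
pose I i (s' : store) := [/\ var s' vI = i%:Z, var s' vADDR = (2 + 3 * i)%N%:Z &
  var s' vACC = acc + \sum_(a <- take i (arcs G') | a.1 == (u, v)) a.2].
apply: (runs_conseq (Q := fun s' => I m s' /\ frame (scan_body j) s1 s')) (leqnn _) _ _.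
  by move=> s' [[_ _ ->] _]; rewrite take_oversize ?size_tuple.
apply: (runs_for_frame (t := cost (scan_body j))).
- by split=> //; rewrite take0 big_nil addr0.
- move=> i s' hi [hI hA hacc'] hf.
  have [hN hM hB hBK hIn] : base s' by apply: base_frame hf hb1 _.
  split; first by rewrite /= hI hM; lia.
  have hsim : sim_mem s' =1 sim_mem s by apply: (sim_mem_frame hf).
  apply: runs_lf => //.
  have [e0 e1 _] := input_arc G (Ordinal hi).
  have hWi := hW (Ordinal hi).
  split; [by rewrite /= hI; lia | by rewrite /= hA; lia |].
  rewrite (take_nth (tnth (arcs G') (Ordinal hi))) ?size_tuple //.
  rewrite -(tnth_nth _ _ (Ordinal hi)) -cats1 big_cat addrA -hacc'.
  rewrite -[LHS]/(var s' vACC + eval s' (scan_incr j)); congr (_ + _).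
  rewrite big_mkcond big_seq1 /scan_incr; cbn [eval].
  rewrite !eval_eqe !eval_sim_get; cbn [eval addr_plus]; rewrite !hsim hu hv hA hI.
  have A0 : (2 + 3 * i)%N%:Z + 0%N%:Z = (3 * i).+2%:Z by lia.
  have A1 : (2 + 3 * i)%N%:Z + 1%N%:Z = (3 * i + 1).+2%:Z by lia.
  rewrite A0 A1 !hIn e0 e1 (proj2 hf) // hWi.
  have -> : (tnth (arcs G') (Ordinal hi)).1 = (tnth (arcs G) (Ordinal hi)).1.
    by rewrite /= tnth_map.
  case: (tnth (arcs G) (Ordinal hi)).1 => x y; rewrite xpair_eqE !eqz_nat /=.
  by rewrite -!val_eqE; case: (_ == _); case: (_ == _).
- move=> s' [hI _ _] hf; have [_ hM _ _ _] : base s' by apply: base_frame hf hb1 _.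
  by rewrite /= hI hM subrr.
Qed.

Definition record_time : nat := (cost (Set_ vBEST (EVar vACC)) + k * cost (copy 0))%N.

Definition check_time : nat :=
  (ecost (eqe (sim_get (EConst 0%R)) (EConst 0%R)) +
   (cost (Set_ vACC (EConst 0%R)) + (k * one_scan_time +
    (ecost (ESub (EVar vBEST) (EVar vACC)) + record_time + 3))) + 3)%N.

Lemma nth_zip_rot (U : Type) (x : U) (c : seq U) j : (j < size c)%N ->
  nth (x, x) (zip c (rot 1 c)) j = (nth x c j, nth x c (j.+1 %% size c)).
Proof.
move=> hj; rewrite nth_zip ?size_rot //; congr (_, _).
case: c hj => // y c hj; rewrite rot1_cons nth_rcons; case: ltnP => hc.
  by rewrite modn_small.
have -> : j = size c by rewrite /= in hj; lia.
by rewrite eqxx modnn.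
Qed.

Lemma check_correct (c : seq 'I_n) Mf s :
  base s -> (forall i : 'I_m, arr s AWt (nat_of_ord i)%:Z = (tnth (arcs G') i).2) ->
  sim_mem s =1 Mf -> holds_output Mf c ->
  runs check check_time s (fun s' =>
    if (size c == k) && (cycle_weight G' c < var s vBEST) then
      var s' vBEST = cycle_weight G' c /\
      forall j : nat, (j < k)%N ->
        arr s' AOut j%:Z = (nth 0%N [seq nat_of_ord x | x <- c] j)%:Z
    else var s' vBEST = var s vBEST /\ arr s' AOut = arr s AOut).
Proof.
move=> hb hW hsim [hc0 hci].
apply: (runs_if (t := (cost (Set_ vACC (EConst 0%R)) + (k * one_scan_time +
    (ecost (ESub (EVar vBEST) (EVar vACC)) + record_time + 3)))%N)); rewrite eval_eqe eval_sim_get hsim /= hc0 eqz_nat;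
  last first.
  case: eqP => // _ _.
  by apply: (runs_conseq (t := 0)) => //; last exact: (runs_lf (c := Skip) (Q := eq s)); move=> s' <-.
case: eqP => // sz _; rewrite andTb.
apply: runs_lf_cat => //; set s1 := lf _ s.
have x0 : 'I_n by case: (c) sz k0 => [<-|].
have wv x : x \notin [:: vI; vADDR; vACC] -> writes_var (iter_cmd scan k) x = false.
  rewrite !inE !negb_or => /and3P[/negbTE h1 /negbTE h2 /negbTE h3].
  by apply: writes_var_iter => l; rewrite /= !eqnE h1 h2 h3.
have wa A : writes_arr (iter_cmd scan k) A = false by apply: writes_arr_iter.
have hMc j : (j < k)%N -> Mf j.+1%:Z = (nat_of_ord (nth x0 c j))%:Z.
  by move=> hj; rewrite hci ?sz // (nth_map x0) ?sz.
pose J j (s' : store) := var s' vACC =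
  \sum_(e <- take j (zip c (rot 1 c))) arc_weight G' e.1 e.2.
have szz : size (zip c (rot 1 c)) = k by rewrite size1_zip ?size_rot.
apply: (runs_cat (runs_iter (I := J) (k := k) (t := one_scan_time) _ _)) => //.
- by rewrite /J take0 big_nil.
- move=> j s' hj hJ hf.
  have hsim' x : sim_mem s' x = Mf x.
    by rewrite -hsim; apply: (sim_mem_frame hf); rewrite wv ?wa.
  apply: (runs_conseq (leqnn _) _ (scan_correct (u := nth x0 c j) (v := nth x0 c (j.+1 %% k))
     (acc := \sum_(e <- take j (zip c (rot 1 c))) arc_weight G' e.1 e.2) _ _ _ _ _)) => //.
  + move=> s2 h2; rewrite /J (take_nth (x0, x0)) ?szz // -cats1 big_cat big_seq1.
    by rewrite nth_zip_rot ?sz // h2.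
  + have hb1 : base s1 by case: hb.
    by apply: base_frame hf hb1 _; rewrite !wv ?wa.
  + by move=> i; rewrite (proj2 hf) ?wa //; exact: hW.
  + by rewrite hsim' hMc.
  + by rewrite hsim' hMc ?ltn_pmod.
move=> s' [hJ hf].
have hacc : var s' vACC = cycle_weight G' c by rewrite hJ take_oversize ?szz.
have hbest : var s' vBEST = var s vBEST by rewrite (proj1 hf) ?wv.
have hout : arr s' AOut = arr s AOut by rewrite (proj2 hf) ?wa.
apply: runs_if; rewrite /= hacc hbest subr_gt0; last first.
  move=> /negbTE ->.
  by apply: (runs_conseq (t := 0)) => //; last exact: (runs_lf (c := Skip) (Q := eq s')); move=> s2 <-.
move=> ->; apply: runs_lf_cat => //; set s2 := lf _ s'.
have hsim2 x : sim_mem s2 x = Mf x.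
  by rewrite -hsim; apply: (sim_mem_frame hf); rewrite wv ?wa.
pose C j (s' : store) := var s' vBEST = cycle_weight G' c /\
  forall i : nat, (i < j)%N -> arr s' AOut i%:Z = (nth 0%N [seq nat_of_ord x | x <- c] i)%:Z.
apply: (runs_conseq (leqnn _) _ (runs_iter (I := C) (k := k) (t := cost (copy 0)) _ _)).
- by move=> s3 [].
- by split.
move=> j s3 hj [hC1 hC2] hf3; apply: runs_lf => //; split=> // i hi /=.
have -> : (if 0 < var s3 vCUR - arr s3 AStamp j.+1%:Z then 0 else arr s3 AVal j.+1%:Z)
    = Mf j.+1%:Z.
  rewrite -hsim2; apply: (sim_mem_frame hf3).
  by rewrite writes_var_iter // !writes_arr_iter.
rewrite hci ?sz // eqz_nat; case: eqP => [->|ne] //.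
by apply: hC2; lia.
Qed.

Variables (S : int) (p : program) (T : nat).
Hypothesis hS : forall a, a \in tval (arcs G) -> `|a.2| <= S.
Hypothesis hB : S *+ (2 * k + 2) + 1 = B.
Hypothesis hp : forall H : wdigraph n m, no_negative_cycle H ->
  exists2 c, outputs p T H c & min_weight_answer H (dicycle H) c.

Definition sim_pre : cmd := Cat (Set_ vPC (EConst 0)) (Set_ vHALT (EConst 0)).

Definition body : cmd := Cat build (Cat sim_pre (Cat (simulate p) check)).

Definition body_time : nat :=
  (build_time + (cost sim_pre + (sim_time p T + check_time)))%N.

(** The first value plays the role of infinity: a k-cycle without bad arcs has reweighted weight at
    most Bk + Sk. *)
Definition best_ok (s : store) : Prop :=
  var s vBEST = B *+ k + S *+ k + 1 \/
  exists c, [/\ simple_kcycle G k c, var s vBEST = cycle_weight G c + B *+ k,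
    var s vBEST <= B *+ k + S *+ k &
    forall j : nat, (j < k)%N ->
      arr s AOut j%:Z = (nth 0%N [seq nat_of_ord x | x <- c] j)%:Z].

Definition loop_invariant (s : store) : Prop :=
  [/\ base s, stamps_ok s, var s vL = L%:Z, var s vS = S & best_ok s].

(** Stable under later calls, since vBEST never increases. *)
Definition covered (s : store) : Prop :=
  forall c, simple_kcycle G k c ->
    (forall i, (i < k)%N -> nth 0%N [seq col x | x <- c] i = i) ->
    var s vBEST <= cycle_weight G c + B *+ k.

Lemma writes_var_check x :
  x \notin [:: vI; vADDR; vACC; vBEST] -> writes_var check x = false.
Proof.
rewrite !inE !negb_or => /and4P[/negbTE h1 /negbTE h2 /negbTE h3 /negbTE h4].
rewrite /check /record; cbn [writes_var]; rewrite !writes_var_iter //.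
  by rewrite !eqnE h3 h4.
by move=> i; rewrite /= !eqnE h1 h2 h3.
Qed.

Lemma writes_arr_check A : writes_arr check A -> A = AOut.
Proof.
rewrite /check /record; cbn [writes_arr].
rewrite (writes_arr_iter (c := scan)) //=; case: (boolP (array_eqb A AOut)) => [/array_eqP //|/negbTE h].
by rewrite writes_arr_iter.
Qed.

Lemma body_correct s :
  loop_invariant s -> seeded k L f s ->
  runs body body_time s (fun s' => [/\ loop_invariant s', covered s',
    var s' vBEST <= var s vBEST & arr s' ASeed = arr s ASeed]).
Proof.
move=> [hb hst hL hvS hbest] hs.
have col_lt u : (col u < k)%N by exact: colour_lt.
have [c [Mf hrun hout] hmin] := hp (reweighted_no_negative (col := col) hS k0 hB).
have [ans1 ans2] := reweighted_answer hS k0 col_lt hB hmin.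
have nwa A : A <> AVal -> A <> AStamp -> A <> AWt -> ~~ writes_arr build A.
  by move=> h1 h2 h3; apply/negP => /writes_arr_build [].
apply: (runs_cat_frame (build_correct hb hs hst)) => s1 [hsim1 hst1 hW1] hf1.
have hb1 : base s1.
  by apply: base_frame hf1 hb _; rewrite !writes_var_build // (negbTE (nwa _ _ _ _)).
apply: runs_lf_cat => //; set s2 := lf _ s1.
have hb2 : base s2 by case: hb1.
have hsim := simulate_correct (s := s2) hrun hsim1 (erefl _) (erefl _) hst1.
apply: (runs_cat_frame hsim) => s3 [hsim3 hst3] hf3.
have nwv3 x : x \notin [:: vPC; vHALT; vTMP] -> ~~ writes_var (simulate p) x.
  by move=> h; rewrite /= writes_var_dispatch.
have nwa3 A : A <> AVal -> A <> AStamp -> ~~ writes_arr (simulate p) A.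
  by move=> h1 h2; apply/negP => /= /writes_arr_dispatch [].
have hb3 : base s3.
  by apply: base_frame hf3 hb2 _; rewrite !(negbTE (nwv3 _ _)) // (negbTE (nwa3 _ _ _)).
have hW3 (i : 'I_m) : arr s3 AWt (nat_of_ord i)%:Z = (tnth (arcs G') i).2.
  by rewrite (proj2 hf3) ?nwa3 //; exact: hW1.
have best3 : var s3 vBEST = var s vBEST.
  by rewrite (proj1 hf3) ?nwv3 // -[LHS]/(var s1 vBEST) (proj1 hf1) ?writes_var_build.
have out3 : arr s3 AOut = arr s AOut.
  by rewrite (proj2 hf3) ?nwa3 // -[LHS]/(arr s1 AOut) (proj2 hf1) ?nwa.
have seed3 : arr s3 ASeed = arr s ASeed.
  by rewrite (proj2 hf3) ?nwa3 // -[LHS]/(arr s1 ASeed) (proj2 hf1) ?nwa.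
have hck := runs_frame (check_correct hb3 hW3 hsim3 hout).
apply: (runs_conseq (leqnn _) _ hck) => s4 [hq hf4].
have nwa4 A : A <> AOut -> ~~ writes_arr check A.
  by move=> h; apply/negP => /writes_arr_check.
have hb4 : base s4.
  by apply: base_frame hf4 hb3 _; rewrite !writes_var_check // (negbTE (nwa4 _ _)).
have hst4 : stamps_ok s4.
  by move=> x; rewrite (proj2 hf4) ?nwa4 // (proj1 hf4) ?writes_var_check.
have hL4 : var s4 vL = L%:Z.
  by rewrite (proj1 hf4) ?writes_var_check // (proj1 hf3) ?nwv3 // -[LHS]/(var s1 vL) (proj1 hf1) ?writes_var_build.
have hS4 : var s4 vS = S.
  by rewrite (proj1 hf4) ?writes_var_check // (proj1 hf3) ?nwv3 // -[LHS]/(var s1 vS) (proj1 hf1) ?writes_var_build.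
have seed4 : arr s4 ASeed = arr s ASeed by rewrite (proj2 hf4) ?nwa4.
have bound : var s vBEST <= B *+ k + S *+ k + 1.
  by case: hbest => [->|[c' [_ _ h _]]] //; lia.
rewrite best3 out3 in hq.
move: hq; case: ifP => [/andP[/eqP sz lt] [h1 h2]|hn [h1 h2]].
  have dc : dicycle G c.
    case: (c) sz hmin => [|x c' _ []]; last by rewrite dicycle_reweighted.
    by move=> e; move: k0; rewrite -e.
  (* Weights are integers, so being below vBEST <= Bk + Sk + 1 means being light. *)
  have le1 : cycle_weight G' c <= B *+ k + S *+ k by lia.
  have [hk hw] := ans1 dc le1.
  split=> //; last by rewrite h1 ltW.
    by split=> //; right; exists c; split=> //; rewrite h1.
  by move=> c' hc' hcol; have [_ _] := ans2 c' hc' hcol; rewrite h1.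
split=> //; last by rewrite h1.
  split=> //; case: hbest => [e|[c' [e1 e2 e3 e4]]]; first by left; rewrite h1.
  by right; exists c'; split=> //; rewrite ?h1 ?h2.
(* A properly coloured cycle forces an answer of length k, so this answer can only have been
   rejected for not improving vBEST. *)
move=> c' hc' hcol; have [_ sz hle] := ans2 c' hc' hcol.
by rewrite h1; rewrite sz eqxx /= in hn; move/negbT: hn; rewrite -leNgt => hn; exact: le_trans hle.
Qed.

End BodyProgram.

(** * Enumerating all seeds *)

Section Nest.
Local Open Scope ring_scope.

Definition seed_cell (t : nat) : expr := EArr ASeed (EConst t%:Z).

Definition seed_init (t : nat) : cmd := SetA ASeed (EConst t%:Z) (EVar vL).

Definition seed_decr (t : nat) : cmd :=
  SetA ASeed (EConst t%:Z) (ESub (seed_cell t) (EConst 1)).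

Variable inner : cmd.

(** The seed entries are themselves the loop counters, each running from L down to 1. A finished
    loop leaves 0 behind, which is reset on the next entry. *)
Fixpoint nest (t : nat) : cmd :=
  if t is t'.+1 then
    Cat (seed_init t') (While (seed_cell t') (Cat (nest t') (seed_decr t')))
  else inner.

Variables (K L tb : nat).

Fixpoint nest_time (t : nat) : nat :=
  (if t is t'.+1 then
    cost (seed_init 0) + (L * (ecost (seed_cell 0) +
      (nest_time t' + cost (seed_decr 0)) + 3) + (ecost (seed_cell 0) + 3))
  else tb)%N.

(** One level around a command of time X costs L(X + 56) + 39. If X <= Y with Y >= 1, this is at
    most 57LY + 39LY = 96LY. *)
Lemma nest_time_le t : (0 < L)%N -> (0 < tb)%N ->
  (nest_time t <= (96 * L) ^ t * tb)%N.
Proof.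
move=> hL htb; elim: t => [|t ih]; first by rewrite expn0 mul1n.
have ge1 : (1 <= (96 * L) ^ t * tb)%N by rewrite muln_gt0 htb expn_gt0 muln_gt0 hL.
rewrite [nest_time _]/= expnS.
rewrite -[(96 * L * _ * _)%N]mulnA -[(96 * L * _)%N]mulnA.
move: (nest_time t) ((96 * L) ^ t * tb)%N ih ge1 => X Y hXY hY.
have h1 : (L * (X + 56) <= 57 * (L * Y))%N.
  by rewrite mulnCA leq_mul2l; apply/orP; right; lia.
have h2 : (1 <= L * Y)%N by rewrite muln_gt0 hL.
by move: h1; rewrite /cost /ecost /= !mulnDr; lia.
Qed.

Variables (Inv : store -> Prop) (Cov : (nat -> nat) -> store -> Prop).
Hypothesis inv_seed : forall s i z, Inv s -> Inv (seta s ASeed i z).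
Hypothesis cov_seed : forall g s i z, Cov g s -> Cov g (seta s ASeed i z).
Hypothesis inv_L : forall s, Inv s -> var s vL = L%:Z.
Hypothesis inner_ok : forall s f, Inv s ->
  (forall t : nat, (t < K)%N -> arr s ASeed t%:Z = (f t)%:Z /\ (0 < f t <= L)%N) ->
  runs inner tb s (fun s' => [/\ Inv s', forall g, (forall t, (t < K)%N -> g t = f t) -> Cov g s',
    forall g, Cov g s -> Cov g s' & arr s' ASeed = arr s ASeed]).

(** The entries from t on are fixed by the surrounding loops; level t covers every seed that agrees
    with them and has its other entries in 1..L. Coverage, once gained, is never lost. *)
Lemma nest_correct t f s : (t <= K)%N -> Inv s ->
  (forall u : nat, (t <= u < K)%N -> arr s ASeed u%:Z = (f u)%:Z /\ (0 < f u <= L)%N) ->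
  runs (nest t) (nest_time t) s (fun s' => [/\ Inv s',
    forall u : nat, (t <= u)%N -> arr s' ASeed u%:Z = arr s ASeed u%:Z,
    forall g, Cov g s -> Cov g s' &
    forall g, (forall u, (u < t)%N -> (0 < g u <= L)%N) ->
      (forall u, (t <= u < K)%N -> g u = f u) -> Cov g s']).
Proof.
elim: t f s => [|t ih] f s ht hI hs.
  apply: (runs_conseq (leqnn _) _ (inner_ok hI (f := f) _)); last by move=> u hu; exact: hs.
  move=> s' [h1 h2 h3 h4]; split=> // [u _|g _ hg]; first by rewrite h4.
  by apply: h2 => u hu; exact: hg.
rewrite [nest _]/= [nest_time _]/=.
apply: (runs_lf_cat (c := seed_init t)) => //; set s1 := lf _ s.
have hL := inv_L hI.
(* After r rounds the values L, ..., L - r + 1 of entry t have been tried. *)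
pose J r s' := [/\ Inv s', arr s' ASeed t%:Z = L%:Z - r%:Z,
  forall u : nat, (t < u)%N -> arr s' ASeed u%:Z = arr s ASeed u%:Z,
  forall g, Cov g s -> Cov g s' &
  forall g, (forall u, (u < t)%N -> (0 < g u <= L)%N) -> (L - r < g t <= L)%N ->
      (forall u, (t < u < K)%N -> g u = f u) -> Cov g s'].
apply: (runs_conseq (Q := J L) (leqnn _)).
  move=> s' [h1 _ h2 h3 h4]; split=> // g hg1 hg2; apply: h4 => //.
  - by move=> u hu; apply: hg1; lia.
  - by have := hg1 t (ltnSn t); lia.
apply: runs_for.
- split.
  + exact: inv_seed.
  + by rewrite /s1 /= eqxx hL subr0.
  + by move=> u hu; rewrite /s1 /=; case: eqP => // -[]; lia.
  + by move=> g hg; exact: cov_seed.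
  + by move=> g _; lia.
- move=> r s' hr [h1 h2 h3 h4 h5]; split; first by rewrite /= h2; lia.
  pose f' u := if u == t then (L - r)%N else f u.
  apply: (runs_cat (ih f' s' _ h1 _)); first by lia.
    move=> u hu; rewrite /f'; case: eqP => [->|ne]; first by rewrite h2; split; lia.
    by rewrite h3; [apply: hs; lia | lia].
  move=> s2 [k1 k2 k3 k4]; apply: runs_lf => //; split=> /=.
  + exact: inv_seed.
  + by rewrite eqxx k2 // h2; lia.
  + by move=> u hu; case: eqP => [[]|_]; [lia | rewrite k2 ?h3 // ltnW].
  + by move=> g hg; apply: cov_seed; apply: k3; exact: h4.
  + move=> g hg1 hg2 hg3; apply: cov_seed; case: (leqP (g t) (L - r)) => hgt; last first.
      by apply: k3; apply: h5 => //; lia.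
    apply: k4 => // u hu; rewrite /f'; case: eqP => [->|ne]; first by lia.
    by apply: hg3; lia.
- by move=> s' [_ h2 _ _ _]; rewrite /= h2 subrr.
Qed.

End Nest.

(** A seed is a function on all numbers, but the enumeration determines only its first 2k^2
    entries. *)
Lemma colour_ext k n f g v :
  (forall t, t < 2 * (k * k) -> g t = f t) -> colour k n g v = colour k n f v.
Proof.
move=> h; rewrite /colour.
suff gen l acc : all (fun i => i < k) l ->
    foldl (fun acc i => if all (pass k n g v i) (iota 0 k) then i else acc) acc l =
    foldl (fun acc i => if all (pass k n f v i) (iota 0 k) then i else acc) acc l.
  by apply: gen; apply/allP => i; rewrite mem_iota.
elim: l acc => //= i l ih acc /andP[hi hl]; rewrite ih //.
suff -> : all (pass k n g v i) (iota 0 k) = all (pass k n f v i) (iota 0 k) by [].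
apply: eq_in_all => j; rewrite mem_iota => hj.
have lt : i * k + j < k * k.
  by apply: (@leq_trans (i.+1 * k)); [rewrite mulSn; lia | rewrite leq_mul2r hi orbT].
by rewrite /pass !h //; lia.
Qed.

(** * The complete program *)

Section MainProgram.
Local Open Scope ring_scope.
Variables (k : nat) (p : program).

Fixpoint emul (q : nat) (e : expr) : expr :=
  if q is q'.+1 then EAdd e (emul q' e) else EConst 0.

Lemma eval_emul s q e : eval s (emul q e) = eval s e *+ q.
Proof. by elim: q => //= q ->; rewrite mulrS. Qed.

(** The loop that follows keeps vPOW equal to 2 to the power vL. It starts from vL = 2, since the
    flags in a seed need the values 1 and 2. *)
Definition init_head : cmd :=
  Cat (Set_ vN (EArr AIn (EConst 0))) (Cat (Set_ vM (EArr AIn (EConst 1)))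
    (Cat (Set_ vL (EConst 2)) (Set_ vPOW (EConst 4)))).

Definition log_body : cmd :=
  Cat (Set_ vPOW (EAdd (EVar vPOW) (EVar vPOW)))
    (Set_ vL (EAdd (EVar vL) (EConst 1))).

Definition log_cond : expr := ESub (EVar vN) (EVar vPOW).

Definition abs_weight : expr :=
  EIf (EArr AIn (addr_plus 2)) (EArr AIn (addr_plus 2))
    (ESub (EConst 0) (EArr AIn (addr_plus 2))).

Definition sum_body : cmd :=
  Cat (Set_ vS (EAdd (EVar vS) abs_weight)) advance.

Definition bound_expr : expr :=
  EAdd (EAdd (emul k (EVar vB)) (emul k (EVar vS))) (EConst 1).

Definition init_tail : cmd :=
  Cat (Set_ vB (EAdd (emul (2 * k + 2) (EVar vS)) (EConst 1)))
    (Cat (Set_ vBK (emul k.+1 (EVar vB))) (Set_ vBEST bound_expr)).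

Definition init : cmd :=
  Cat init_head (Cat (While log_cond log_body)
    (Cat start_scan (Cat (While more_arcs sum_body) init_tail))).

(** The cells of [AIn] with nonnegative index are the machine cells of the same number, where the
    output is expected. *)
Definition output_cell (j : nat) : cmd :=
  SetA AIn (EConst j.+1%:Z) (EArr AOut (EConst j%:Z)).

Definition finish : cmd :=
  If_ (ESub bound_expr (EVar vBEST))
    (Cat (SetA AIn (EConst 0) (EConst k%:Z)) (iter_cmd output_cell k))
    (SetA AIn (EConst 0) (EConst 0)).

Definition main : cmd := Cat init (Cat (nest (body k p) (2 * (k * k))) finish).

Variables (n m : nat) (G : wdigraph n m).

Definition start_store : store :=
  MkStore (fun=> 0) (fun A i => if A is AIn then input G i else 0).

Lemma agrees_start : agrees (input G) start_store.
Proof. by split=> // A [i|i]; case: A. Qed.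

Definition log_steps : nat := up_log 2 n - 2.
Definition seed_bound : nat := log_steps + 2.
Definition total : int := \sum_(a <- arcs G) `|a.2|.
Definition base_weight : int := total *+ (2 * k + 2) + 1.

Lemma seed_bound_ge : (n <= 2 ^ seed_bound)%N.
Proof.
apply: leq_trans (up_logP n (isT : (1 < 2)%N)) _.
by rewrite leq_exp2l // /seed_bound /log_steps; lia.
Qed.

Lemma seed_bound_le : (seed_bound <= 2 * (trunc_log 2 n).+1)%N.
Proof.
rewrite /seed_bound /log_steps; case: (leqP n 1) => h.
  by have : up_log 2 n = 0 by [case: (n) h => [|[|]]]; lia.
rewrite up_log_trunc_log //; have := @leq_trunc_log 2 n.-1 n; lia.
Qed.

Lemma total_ge a : a \in tval (arcs G) -> `|a.2| <= total.
Proof.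
move=> ha; rewrite /total (big_rem a) //= lerDl.
by apply: sumr_ge0 => *; exact: normr_ge0.
Qed.

Definition init_time : nat :=
  (cost init_head + ((log_steps * (ecost log_cond + cost log_body + 3) + (ecost log_cond + 3)) +
   (cost start_scan + (scan_time m (cost sum_body) + cost init_tail))))%N.

Lemma init_correct :
  runs init init_time start_store (loop_invariant k G seed_bound base_weight total).
Proof.
apply: runs_lf_cat => //; set s1 := lf _ _.
pose I r (s' : store) := var s' vPOW = (2 ^ (r + 2))%N%:Z /\ var s' vL = (r + 2)%N%:Z.
apply: (runs_cat_frame (runs_for_frame (I := I) (N := log_steps) (t := cost log_body) _ _ _)).
- by split.
- move=> r s' hr [h1 h2] hf.
  have hN : var s' vN = n%:Z by rewrite (proj1 hf).
  split.
    rewrite /= hN h1 subr_gt0 ltz_nat ltnNge; apply/negP => hle.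
    by have := up_log_min (isT : (1 < 2)%N) hle; rewrite /log_steps in hr; lia.
  by apply: runs_lf => //; split=> /=; rewrite ?h1 ?h2 ?addSn ?expnS; lia.
- move=> s' [h1 h2] hf; have hN : var s' vN = n%:Z by rewrite (proj1 hf).
  by rewrite /= hN h1 subr_gt0 ltz_nat -leqNgt seed_bound_ge.
move=> s2 [[_ hL2] hf2] _.
have v2 x : x \notin [:: vPOW; vL] -> var s2 x = var s1 x.
  rewrite !inE negb_or => /andP[/negbTE h1 /negbTE h2].
  by rewrite (proj1 hf2) //= !eqnE h1 h2.
have a2 A : arr s2 A = arr start_store A by rewrite (proj2 hf2).
apply: runs_lf_cat => //; set s3 := lf _ _.
pose J i (s' : store) := [/\ var s' vI = i%:Z, var s' vADDR = (2 + 3 * i)%N%:Z &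
  var s' vS = \sum_(a <- take i (arcs G)) `|a.2|].
apply: (runs_cat_frame (runs_for_frame (I := J) (N := m) (t := cost sum_body) _ _ _)).
- by split=> //; rewrite take0 big_nil /s3 /= v2.
- move=> i s' hi [h1 h2 h3] hf.
  have hM : var s' vM = m%:Z by rewrite (proj1 hf) // /s3 /= v2.
  split; first by rewrite /= hM h1; lia.
  apply: runs_lf => //.
  split; [by rewrite /= h1; lia | by rewrite /= h2; lia |].
  rewrite (take_nth (tnth (arcs G) (Ordinal hi))) ?size_tuple //.
  rewrite -(tnth_nth _ _ (Ordinal hi)) -cats1 big_cat big_seq1 -h3.
  rewrite -[LHS]/(var s' vS + eval s' abs_weight); congr (_ + _).
  have [_ _ e2] := input_arc G (Ordinal hi).
  have A2 : (2 + 3 * i)%N%:Z + 2%N%:Z = (3 * i + 2).+2%:Z by lia.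
  have a3 : arr s' AIn (3 * i + 2).+2%:Z = (tnth (arcs G) (Ordinal hi)).2.
    by rewrite (proj2 hf) // -[arr s3 AIn]/(arr s2 AIn) a2 -e2.
  by cbn [eval abs_weight addr_plus]; rewrite h2 A2 a3; case: ifP; lia.
- move=> s' [h1 _ _] hf; have hM : var s' vM = m%:Z by rewrite (proj1 hf) // /s3 /= v2.
  by rewrite /= hM h1 subrr.
move=> s4 [[_ _ hS4] hf4] _.
rewrite take_oversize ?size_tuple // -/total in hS4.
have v4 x : x \notin [:: vPOW; vL; vS; vI; vADDR] -> var s4 x = var s1 x.
  rewrite !inE !negb_or => /and5P[/negbTE h1 /negbTE h2 /negbTE h3 /negbTE h4 /negbTE h5].
  rewrite (proj1 hf4) /= ?eqnE ?h3 ?h4 ?h5 // ?eqnE ?h4 ?h5 v2 // !inE h1 h2 //.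
have a4 A : arr s4 A = arr start_store A by rewrite (proj2 hf4) // -[LHS]/(arr s2 A).
have L4 : var s4 vL = seed_bound%:Z by rewrite (proj1 hf4).
apply: runs_lf => //; set s5 := lf _ _.
have hB5 : var s5 vB = base_weight.
  by rewrite -[LHS]/(eval s4 (emul (2 * k + 2) (EVar vS)) + 1) eval_emul /= hS4.
have hBK5 : var s5 vBK = base_weight *+ k.+1.
  rewrite -hB5 -[LHS]/(eval (lf (Set_ vB (EAdd (emul (2 * k + 2) (EVar vS)) (EConst 1))) s4)
    (emul k.+1 (EVar vB))).
  by rewrite eval_emul.
split.
- split=> //; [by rewrite /s5 /= v4 | by rewrite /s5 /= v4 |].
  by move=> i; rewrite /s5 /= a4.
- by move=> x; rewrite /s5 /= a4 v4.
- by rewrite /s5 /= L4.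
- by rewrite /s5 /= hS4.
- left; rewrite -hB5 -[LHS]/(eval (lf (Set_ vBK (emul k.+1 (EVar vB)))
    (lf (Set_ vB (EAdd (emul (2 * k + 2) (EVar vS)) (EConst 1))) s4)) bound_expr).
  by rewrite /bound_expr; cbn [eval]; rewrite !eval_emul /= hS4.
Qed.

Variable T : nat.
Hypothesis k0 : (0 < k)%N.
Hypothesis hp : forall H : wdigraph n m, no_negative_cycle H ->
  exists2 c, outputs p T H c & min_weight_answer H (dicycle H) c.

Definition finish_time : nat :=
  (ecost (ESub bound_expr (EVar vBEST)) +
   (cost (SetA AIn (EConst 0%R) (EConst 0%R)) + k * cost (output_cell 0)) + 3)%N.

Definition main_time : nat :=
  (init_time + (nest_time seed_bound (body_time k m seed_bound p T) (2 * (k * k)) +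
   finish_time))%N.

(** Some enumerated seed colours any given k-cycle properly, so vBEST is at most its weight plus Bk.
    The recorded cycle, if any, is therefore optimal. If none was recorded, vBEST still is Bk + Sk +
    1, more than a k-cycle would allow. *)
Lemma main_correct :
  runs main main_time start_store (fun s' => exists2 c,
    min_weight_answer G (simple_kcycle G k) c &
    arr s' AIn 0 = (size c)%:Z /\ forall i : nat, (i < size c)%N ->
      arr s' AIn i.+1%:Z = (nth 0%N [seq nat_of_ord x | x <- c] i)%:Z).
Proof.
pose Inv := loop_invariant k G seed_bound base_weight total.
pose Cov g s := covered k G g base_weight s.
apply: (runs_cat init_correct) => s1 inv1.
have hS a : a \in tval (arcs G) -> `|a.2| <= total by exact: total_ge.
(* At the outermost level no entry is fixed yet, so the fixed part of the seed is arbitrary. *)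
apply: (runs_cat (nest_correct (K := 2 * (k * k)) (L := seed_bound) (Inv := Inv) (Cov := Cov)
   (f := fun=> 0%N) _ _ _ _ _ inv1 _)) => //.
- by move=> s [_ _ h _ _].
- move=> s f inv hs.
  apply: (runs_conseq (leqnn _) _ (body_correct k0 hS (erefl _) hp inv hs)).
  move=> s' [h1 h2 h3 h4]; split=> // [g hg c hc hcol|g hg c hc hcol].
    apply: h2 => // i hi; rewrite -[RHS]hcol //; congr nth; apply: eq_map => x.
    by apply/esym; apply: colour_ext => t ht; exact: hg.
  by apply: le_trans h3 _; exact: hg.
- by move=> u; lia.
move=> s2 [[hb2 _ _ hS2 best2] _ _ cov2].
have cov c : simple_kcycle G k c -> var s2 vBEST <= cycle_weight G c + base_weight *+ k.
  move=> hc; have [_ uc /eqP sc] := and3P hc.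
  have n0 : (0 < n)%N by case: (c) sc => [e|x _ _]; [move: k0; rewrite -e | exact: leq_trans (ltn_ord x)].
  have [|||||g hg hcol] := @colour_realizes k n seed_bound [seq nat_of_ord x | x <- c] _ _ _ _ seed_bound_ge.
  - by rewrite map_inj_uniq //; exact: val_inj.
  - by rewrite size_map.
  - by [].
  - by apply/allP => x /mapP[y _ ->].
  - by rewrite /seed_bound; lia.
  apply: (cov2 g) => // [u|i hi]; first by lia.
  by rewrite -[RHS]hcol // -[RHS](nth_map 0%N 0%N) ?size_map ?sc // -map_comp.
have bnd : eval s2 bound_expr = base_weight *+ k + total *+ k + 1.
  have [_ _ hB2 _ _] := hb2.
  by rewrite /bound_expr; cbn [eval]; rewrite !eval_emul /= hB2 hS2.
apply: runs_if; cbn [eval]; rewrite bnd subr_gt0 => hlt.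
  case: best2 => [e|[c [hc hw hle hout]]]; first by rewrite e ltxx in hlt.
  have [_ _ /eqP sc] := and3P hc.
  apply: runs_lf_cat => //; set s3 := lf _ _.
  pose J j (s' : store) := arr s' AIn 0 = k%:Z /\ forall i : nat, (i < j)%N ->
      arr s' AIn i.+1%:Z = (nth 0%N [seq nat_of_ord x | x <- c] i)%:Z.
  apply: (runs_conseq (leqnn _) _ (runs_iter (I := J) (k := k) (t := cost (output_cell 0)) _ _)).
  - move=> s' [[h1 h2] _]; exists c; rewrite ?sc //.
    case: (c) sc hc hw {hout h2} => [e|x c' sc hc hw]; first by move: k0; rewrite -e.
    by split=> // c2 hc2; have := cov c2 hc2; rewrite hw lerD2r.
  - by split.
  move=> j s' hj [h1 h2] hf; apply: runs_lf => //; split=> //= i hi.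
  case: eqP => [[->]|ne]; last by apply: h2; have : i <> j by [move=> e; apply: ne; rewrite e]; lia.
  by rewrite (proj2 hf) ?writes_arr_iter //; exact: hout.
apply: (runs_conseq (t := cost (SetA AIn (EConst 0) (EConst 0)))); last first.
- by apply: runs_lf => //; exact: (erefl (lf (SetA AIn (EConst 0) (EConst 0)) s2)).
- move=> s' <-; exists [::] => //= c; apply/negP => hc.
  have [dc _ /eqP sc] := and3P hc.
  have := cov c hc; have := cycle_weight_le hS dc; rewrite sc => h1 h2.
  by move: hlt; rewrite -leNgt => hlt; lia.
- by rewrite leq_addr.
Qed.

End MainProgram.

(** * The running time *)

Section TimeBound.

(** O-notation with a constant uniform in all parameters. Three bounds suffice: L for computing a
    colour, T for the simulation and the passes over the arcs, LT for building an instance. *)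
Definition dominated (q g : nat -> nat -> nat -> nat) : Prop :=
  exists C, forall L m T, 0 < L -> 0 < T -> m <= 9 * T -> g L m T <= C * q L m T.

Definition qL (L m T : nat) : nat := L.
Definition qT (L m T : nat) : nat := T.
Definition qLT (L m T : nat) : nat := L * T.

Lemma dominated_add q g h : dominated q g -> dominated q h ->
  dominated q (fun L m T => g L m T + h L m T).
Proof.
move=> [C hC] [D hD]; exists (C + D) => L m T h1 h2 h3.
by rewrite mulnDl leq_add ?hC ?hD.
Qed.

Lemma dominated_scale q c g : dominated q g -> dominated q (fun L m T => c * g L m T).
Proof.
move=> [C hC]; exists (c * C) => L m T h1 h2 h3.
by rewrite -mulnA leq_mul2l hC ?orbT.
Qed.

Lemma dominated_scaler q c g : dominated q g -> dominated q (fun L m T => g L m T * c).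
Proof.
move=> /(dominated_scale c) [C hC]; exists C => L m T h1 h2 h3.
by rewrite mulnC hC.
Qed.

Lemma dominated_mul g h : dominated qL g -> dominated qT h ->
  dominated qLT (fun L m T => h L m T * g L m T).
Proof.
move=> [C hC] [D hD]; exists (C * D) => L m T h1 h2 h3.
by rewrite /qLT mulnACA mulnC leq_mul ?hC ?hD.
Qed.

Lemma dominatedL_const c : dominated qL (fun _ _ _ => c).
Proof. by exists c => L m T h1 _ _; rewrite leq_pmulr. Qed.

Lemma dominatedT_const c : dominated qT (fun _ _ _ => c).
Proof. by exists c => L m T _ h2 _; rewrite leq_pmulr. Qed.

Lemma dominatedL_L : dominated qL (fun L _ _ => L).
Proof. by exists 1 => L m T _ _ _; rewrite mul1n. Qed.

Lemma dominatedT_T : dominated qT (fun _ _ T => T).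
Proof. by exists 1 => L m T _ _ _; rewrite mul1n. Qed.

Lemma dominatedT_m : dominated qT (fun _ m _ => m).
Proof. by exists 9. Qed.

Lemma dominated_L_LT g : dominated qL g -> dominated qLT g.
Proof.
move=> [C hC]; exists C => L m T h1 h2 h3; apply: leq_trans (hC _ _ _ h1 h2 h3) _.
by rewrite leq_mul2l leq_pmulr ?orbT.
Qed.

Lemma dominated_T_LT g : dominated qT g -> dominated qLT g.
Proof.
move=> [C hC]; exists C => L m T h1 h2 h3; apply: leq_trans (hC _ _ _ h1 h2 h3) _.
by rewrite leq_mul2l leq_pmull ?orbT.
Qed.

Lemma dominated_colour_time k : dominated qL (fun L _ _ => colour_time k L).
Proof.
apply: dominated_add; first exact: dominatedL_const.
apply: dominated_scale; apply: dominated_add; first exact: dominatedL_const.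
apply: dominated_add; last exact: dominatedL_const.
apply: dominated_scale; apply: dominated_add; first exact: dominatedL_const.
apply: dominated_add; last exact: dominatedL_const.
apply: dominated_add; last exact: dominatedL_const.
apply: dominated_scaler; exact: dominatedL_L.
Qed.

Lemma dominated_body_time k p :
  dominated qLT (fun L m T => body_time k m L p T).
Proof.
apply: dominated_add.
  apply: dominated_add; first by apply: dominated_L_LT; exact: dominatedL_const.
  apply: dominated_add; last by apply: dominated_L_LT; exact: dominatedL_const.
  apply: dominated_mul; last exact: dominatedT_m.
  apply: dominated_add; last exact: dominatedL_const.
  apply: dominated_add; first exact: dominatedL_const.
  apply: dominated_add; first exact: dominatedL_const.
  apply: dominated_add; first exact: dominated_colour_time.
  apply: dominated_add; first exact: dominatedL_const.
  by apply: dominated_add; [exact: dominated_colour_time | exact: dominatedL_const].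
apply: dominated_T_LT; apply: dominated_add; first exact: dominatedT_const.
apply: dominated_add.
  apply: dominated_add; last exact: dominatedT_const.
  by apply: dominated_scaler; exact: dominatedT_T.
apply: dominated_add; last exact: dominatedT_const.
apply: dominated_add; first exact: dominatedT_const.
apply: dominated_add; first exact: dominatedT_const.
apply: dominated_add; last exact: dominatedT_const.
apply: dominated_scale; apply: dominated_add; first exact: dominatedT_const.
apply: dominated_add; last exact: dominatedT_const.
by apply: dominated_scaler; exact: dominatedT_m.
Qed.

Lemma dominated_init_time k : exists C, forall n m T,
  0 < T -> m <= 9 * T -> init_time k n m <= C * (seed_bound n * T).
Proof.
have [C hC] : dominated qLT (fun L m T => cost init_head +
    ((L * (ecost log_cond + cost log_body + 3) + (ecost log_cond + 3)) +
     (cost start_scan + (scan_time m (cost sum_body) + cost (init_tail k))))).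
  apply: dominated_add; first by apply: dominated_L_LT; exact: dominatedL_const.
  apply: dominated_add.
    apply: dominated_L_LT; apply: dominated_add; last exact: dominatedL_const.
    by apply: dominated_scaler; exact: dominatedL_L.
  apply: dominated_T_LT; apply: dominated_add; first exact: dominatedT_const.
  apply: dominated_add; last exact: dominatedT_const.
  apply: dominated_add; last exact: dominatedT_const.
  by apply: dominated_scaler; exact: dominatedT_m.
exists C => n m T hT hm; apply: leq_trans (hC (seed_bound n) m T _ hT hm) => //.
  by rewrite leq_add2l leq_add2r leq_add2r leq_mul2r leq_addr orbT.
by rewrite /seed_bound addn2.
Qed.

(** O(L^(2k^2)) calls of cost O(LT), where L is at most twice the successor of the logarithm. The
    inequality is strict to leave room for the halting step of the machine. *)
Lemma main_time_le k p : exists C, forall n m T, 0 < T -> m <= 9 * T ->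
  main_time k p n m T < C * T * (trunc_log 2 n).+1 ^ (2 * (k * k)).+1.
Proof.
have [C1 h1] := dominated_init_time k; have [C2 h2] := dominated_body_time k p.
set K := 2 * (k * k).
exists ((C1 + 96 ^ K * C2 + finish_time k + 1) * 2 ^ K.+1) => n m T hT hm.
set L := seed_bound n; have L0 : 0 < L by rewrite /L /seed_bound addn2.
have LT : 0 < L ^ K * (L * T) by rewrite !muln_gt0 expn_gt0 L0.
have tb : 0 < body_time k m L p T by rewrite /body_time /= addn_gt0 orbC.
rewrite (@leq_trans ((C1 + 96 ^ K * C2 + finish_time k + 1) * (L ^ K * (L * T)))) //.
  have a1 : init_time k n m <= C1 * (L ^ K * (L * T)).
    apply: leq_trans (h1 n m T hT hm) _.
    by rewrite leq_mul2l [L * T <= _]leq_pmull ?orbT // expn_gt0 L0.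
  have a2 : nest_time L (body_time k m L p T) K <= 96 ^ K * C2 * (L ^ K * (L * T)).
    apply: leq_trans (nest_time_le K L0 tb) _.
    rewrite expnMn -!mulnA leq_mul2l; apply/orP; right.
    rewrite mulnCA leq_mul2l; apply/orP; right.
    exact: (h2 L m T L0 hT hm).
  have a3 : finish_time k <= finish_time k * (L ^ K * (L * T)) by rewrite leq_pmulr.
  have e a b c x : (a + b + c + 1) * x = a * x + b * x + c * x + x.
    by rewrite !mulnDl mul1n.
  rewrite e; apply: leq_trans (leq_add (leq_add (leq_add a1 a2) a3) LT).
  by rewrite addn1 -addnA.
have e a x y z : a * (x * (y * z)) = a * (x * y) * z by rewrite !mulnA.
have e' a x y z : a * x * y * z = a * (x * z) * y by rewrite mulnAC !mulnA.
rewrite e e' -expnSr -expnMn leq_mul2r; apply/orP; right.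
by rewrite leq_mul2l leq_exp2r // seed_bound_le orbT.
Qed.

End TimeBound.

Theorem theorem6p1 (k : nat) (hk : 0 < k) (T : nat -> nat -> nat)
    (hT : shortest_cycle_solvable_in T) :
  exists2 T' : nat -> nat -> nat,
    soft_O T T' & min_weight_kcycle_solvable_in k T'.
Proof.
have [p hp] := hT; have [C hC] := main_time_le k p.
exists (fun n m => C * T n m * (trunc_log 2 n).+1 ^ (2 * (k * k)).+1).
  by exists C, (2 * (k * k)).+1.
exists (comp 0 (main k p)) => n m G.
(* The lower bound on T is needed only at pairs (n, m) for which a graph exists, and there the input
   itself provides it. *)
have [T0 hm] := shortest_cycle_time_ge hp G.
have [t [s [le ex [c hc [hs0 hsi]]]]] := main_correct G hk (hp n m).
have hcode : code_at (comp 0 (main k p)) 0 (comp 0 (main k p)) by [].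
have [M hr [_ ha]] := comp_correct ex hcode (agrees_start G).
exists c => //; exists M.
  by apply: reach_run hr _ _ => //; exact: leq_ltn_trans le (hC n m _ T0 hm).
split; first by rewrite -hs0 -ha.
by move=> i hi; rewrite -hsi // -ha.
Qed.
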